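(* Let $(G_N)_{N\ge 1}$ be a sequence of random graphs that is locally tree-like with asymptotic degree $D$, uniformly sparse, and whose asymptotic degree distribution (the law of $D$) has strongly finite mean. Then for all $(\beta,B)\in\mathcal U^{\mathrm{qu}}$, for almost every realization of the graph sequence, $S_N/N$ converges in probability exponentially fast to $M(\beta,B)$ with respect to $\mu_{G_N}$ as $N\to\infty$; that is, for every $\varepsilon>0$ there is $L=L(\varepsilon)>0$ such that $$\mu_{G_N}\left(\left|\frac{S_N}{N}-M(\beta,B)\right|\ge \varepsilon\right)\le e^{-NL}\qquad\text{for all sufficiently large } N .$$
   Context: Graphs. $G_N$ is a random graph (possibly a multigraph) with vertex set $[N]=\{1,\dots,N\}$ and edge set $E_N$ (sums over $E_N$ count each edge once, with multiplicity). $D$ is a random variable on $\{1,2,\dots\}$ with $\mathbb P(D=k)=p_k$ and $\mathbb E[D]<\infty$; $\rho_k=(k+1)p_{k+1}/\mathbb E[D]$, $k\ge0$, is its size-biased law, and $\nu=\sum_{k\ge 0}k\rho_k=\mathbb E[D(D-1)]/\mathbb E[D]\in[0,\infty]$. $\mathcal T(D,\rho,\ell)$ is the random rooted tree given by a branching process with $\ell$ generations in which the root has offspring number distributed as $D$ and all vertices in later generations have i.i.d. offspring numbers with law $\rho$. $B_i(t)$ is the subgraph of $G_N$ induced by the vertices at graph distance at most $t$ from $i$, rooted at $i$; $\cong$ is isomorphism of rooted graphs. - $(G_N)$ is locally tree-like with asymptotic degree $D$ if, for every $t$ and every rooted tree $\mathcal T$ with $t$ generations, almost surely $\lim_{N\to\infty}\mathbb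 P_N(B_i(t)\cong\mathcal T)=\mathbb P(\mathcal T(D,\rho,t)\cong\mathcal T)$, where $\mathbb P_N$ refers to the uniform choice of $i\in[N]$ (given $G_N$). - $(G_N)$ is uniformly sparse if almost surely $\lim_{\ell\to\infty}\limsup_{N\to\infty}\frac1N\sum_{i\in[N]}d_i\mathbf 1_{\{d_i\ge\ell\}}=0$, where $d_i$ is the degree of $i$ in $G_N$. - The law of $D$ has strongly finite mean if there are $\tau>2$, $c>0$ with $\sum_{i\ge k}p_i\le ck^{-(\tau-1)}$ for all $k\ge 1$. Ising model. For $\beta\ge0$, $B\in\mathbb R$ and $\sigma\in\{-1,1\}^N$, the random quenched measure is $$\mu_{G_N}(\sigma)=\frac{1}{Z_N(\beta,B)}\exp\Big[\beta\sum_{(i,j)\in E_N}\sigma_i\sigma_j+B\sum_{i\in[N]}\sigma_i\Big],$$ with $Z_N(\beta,B)$ the normalizing partition function; $\mu_{G_N}(\cdot)$ also denotes expectation. $S_N=\sum_{i\in[N]}\sigma_i$, $M_N(\beta,B)=\mu_{G_N}(S_N/N)$. The critical inverse temperature is $\beta_c^{\mathrm{qu}}=\operatorname{atanh}(1/\nu)$ (with value $+\infty$ if $\nu\le1$ and $0$ if $\nu=\infty$), and $$\mathcal U^{\mathrm{qu}}=\{(\beta,B):\beta\ge0,\ B\ne0\}\cup\{(\beta,B):0<\beta<\beta_c^{\mathrm{qu}},\ B=0\}.$$ It is known that, for such graph sequences, the pressure $\psi(\beta,B)=\lim_{N\to\infty}\frac1N\log Z_N(\beta,B)$ exists almost surely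 and is non-random for all $\beta\ge 0$, $B\in\mathbb R$, and that for $(\beta,B)\in\mathcal U^{\mathrm{qu}}$ the magnetization $M(\beta,B)=\lim_{N\to\infty}M_N(\beta,B)$ exists almost surely, with $M(\beta,B)=\frac{\partial}{\partial B}\psi(\beta,B)$ for $B\neq0$ and $M(\beta,0)=0$ for $0<\beta<\beta_c^{\mathrm{qu}}$. *)

(* Defs.v *)
From HB Require Import structures.
From mathcomp Require Import all_boot all_order all_algebra.
From mathcomp Require Import all_classical all_reals all_analysis.

Set Implicit Arguments.
Unset Strict Implicit.
Unset Printing Implicit Defensive.
Import Order.TTheory GRing.Theory Num.Theory.
Import numFieldNormedType.Exports.

Local Open Scope classical_set_scope.
Local Open Scope ring_scope.

(** * Multigraphs on [N] and rooted graphs *)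

(* A multigraph is given by its symmetric edge multiplicities; [mult i i] is
   the number of self-loops at [i]. The vertex set [N] is ['I_N]. *)
Record mgraph (N : nat) := MGraph {
  mult :> 'I_N -> 'I_N -> nat ;
  multC : forall i j, mult i j = mult j i }.

(* A self-loop contributes 2 to the degree. *)
Definition degree (N : nat) (g : mgraph N) (i : 'I_N) : nat :=
  (\sum_(j < N) g i j + g i i)%N.

(* A rooted multigraph whose vertex set is a subset [verts] of a type; only the
   multiplicities between elements of [verts] matter. *)
Record rgraph := RGraph {
  vert : Type ;
  verts : set vert ;
  groot : vert ;
  gmult : vert -> vert -> nat }.

Arguments verts : clear implicits.
Arguments gmult : clear implicits.

Definition rg_iso (g h : rgraph) : Prop :=
  exists f : vert g -> vert h,
    [/\ set_bij (verts g) (verts h) f,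
        f (groot g) = groot h &
        forall u v, verts g u -> verts g v ->
          gmult h (f u) (f v) = gmult g u v].

Definition ball_verts (N : nat) (g : mgraph N) (i : 'I_N) (t : nat) :
    set 'I_N :=
  [set j | exists s : seq 'I_N,
     [/\ path (fun u v => (0 < g u v)%N) i s, last i s = j & (size s <= t)%N]].

Definition nbhd (N : nat) (g : mgraph N) (i : 'I_N) (t : nat) : rgraph :=
  @RGraph 'I_N (ball_verts g i t) i g.

(** * Finite rooted trees *)

(* Plane (ordered) trees. Every finite rooted tree is isomorphic to the rooted
   graph [tree_graph T] of some plane tree [T]. *)
Inductive ptree := PNode of seq ptree.

Definition children (T : ptree) : seq ptree := let: PNode s := T in s.

Fixpoint ptree_encode (T : ptree) : GenTree.tree unit :=
  let: PNode s := T in GenTree.Node 0 (map ptree_encode s).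

Fixpoint ptree_decode (x : GenTree.tree unit) : ptree :=
  match x with
  | GenTree.Leaf _ => PNode [::]
  | GenTree.Node _ s => PNode (map ptree_decode s)
  end.

Lemma ptree_encodeK : cancel ptree_encode ptree_decode.
Proof.
rewrite /cancel; fix IH 1 => -[s] /=; congr PNode.
by elim: s => //= T s ->; rewrite IH.
Qed.

HB.instance Definition _ := Choice.copy ptree (can_type ptree_encodeK).

Fixpoint depth_le (t : nat) (T : ptree) : bool :=
  if t is t'.+1 then all (depth_le t') (children T) else nilp (children T).

(* The vertices of [T] are its Ulam-Harris addresses: [[::]] is the root, and
   [k :: u] is the vertex [u] of the subtree hanging from the [k]-th child of
   the root. *)
Fixpoint address (T : ptree) (u : seq nat) : bool :=
  if u is k :: u' then
    (k < size (children T))%N && address (nth T (children T) k) u'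
  else true.

Definition child_of (u v : seq nat) : bool :=
  prefix u v && (size v == (size u).+1).

Definition tree_graph (T : ptree) : rgraph :=
  @RGraph (seq nat) [set u | address T u] [::]
    (fun u v => child_of u v || child_of v u : nat).

(** * Degree distribution and branching process *)

Section DegreeLaw.
Context {R : realType}.
Implicit Types (p q rho : nat -> R).

(* [p] is the law of a random variable on {1, 2, ...} with finite mean. *)
Definition degree_law p : Prop :=
  [/\ forall k, 0 <= p k,
      p 0%N = 0,
      (\sum_(0 <= k <oo) (p k)%:E = 1)%E &
      (\sum_(0 <= k <oo) (k%:R * p k)%:E < +oo)%E].

Definition mean_degree p : R := fine (\sum_(0 <= k <oo) (k%:R * p k)%:E)%E.

Definition size_biased p (k : nat) : R := k.+1%:R * p k.+1 / mean_degree p.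

Definition nu p : \bar R := (\sum_(0 <= k <oo) (k%:R * size_biased p k)%:E)%E.

(* Law, on plane trees, of the branching process with [t] generations in which
   all offspring numbers are i.i.d. with law [rho]: vertices of generation [t]
   have no children, and every vertex of an earlier generation contributes the
   probability of its offspring number. *)
Fixpoint gw_weight rho (t : nat) (T : ptree) : R :=
  if t is t'.+1 then
    rho (size (children T)) * \prod_(T' <- children T) gw_weight rho t' T'
  else (nilp (children T))%:R.

(* The same, but with offspring law [q] at the root. *)
Definition bp_weight q rho (t : nat) (T : ptree) : R :=
  if t is t'.+1 then
    q (size (children T)) * \prod_(T' <- children T) gw_weight rho t' T'
  else (nilp (children T))%:R.

(* The probability that the branching process tree is isomorphic, as a rooted
   (unordered) tree, to [T]. *)
Definition bp_prob q rho (t : nat) (T : ptree) : \bar R :=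
  (\esum_(T' in [set T' | rg_iso (tree_graph T') (tree_graph T)])
     (bp_weight q rho t T')%:E)%E.

Definition strongly_finite_mean p : Prop :=
  exists tau c : R, [/\ 2 < tau, 0 < c &
    forall k : nat, (1 <= k)%N ->
      (\sum_(k <= i <oo) (p i)%:E <= (c * k%:R `^ (- (tau - 1)))%:E)%E].

Definition atanh (x : R) : R := ln ((1 + x) / (1 - x)) / 2.

Definition beta_c p : \bar R :=
  if (nu p <= 1)%E then +oo%E
  else if nu p == +oo%E then 0%E
  else (atanh (1 / fine (nu p)))%:E.

Definition U_qu p (beta B : R) : Prop :=
  (0 <= beta /\ B != 0) \/ [/\ 0 < beta, (beta%:E < beta_c p)%E & B = 0].

End DegreeLaw.

(** * Sequences of random multigraphs *)

Section RandomGraphs.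
Context {R : realType} {d : measure_display} {Omega : measurableType d}.
Variable P : probability Omega R.
Variable G : forall N : nat, Omega -> mgraph N.

Definition random_graphs : Prop :=
  forall N (i j : 'I_N), measurable_fun setT (fun w => G N w i j).

(* P_N (B_i(t) ~ T), with i uniform in [N]. *)
Definition nbhd_freq (N : nat) (g : mgraph N) (t : nat) (T : ptree) : R :=
  (\sum_(i < N) (`[< rg_iso (nbhd g i t) (tree_graph T) >])%:R) / N%:R.

Definition locally_tree_like (p : nat -> R) : Prop :=
  forall (t : nat) (T : ptree), depth_le t T ->
    {ae P, forall w, (fun N => (nbhd_freq (G N w) t T)%:E) @ \oo -->
                     bp_prob p (size_biased p) t T}.

Definition large_degree_mean (N : nat) (g : mgraph N) (l : nat) : R :=
  (\sum_(i < N) (degree g i)%:R * (l <= degree g i)%N%:R) / N%:R.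

Definition uniformly_sparse : Prop :=
  {ae P, forall w,
    (fun l => limn_esup (fun N => (large_degree_mean (G N w) l)%:E)) @ \oo
      --> 0%E}.

End RandomGraphs.

(** * Ising model *)

Section Ising.
Context {R : realType} {N : nat}.
Implicit Types (g : mgraph N) (s : {ffun 'I_N -> bool}).

(* A configuration in {-1, 1}^N is encoded by booleans, [true] being +1. *)
Definition spin s (i : 'I_N) : R := if s i then 1 else -1.

Definition total_spin s : R := \sum_(i < N) spin s i.

(* The sum over pairs i <= j counts each edge once, with multiplicity. *)
Definition boltzmann g (beta B : R) s : R :=
  expR (beta * (\sum_(i < N) \sum_(j < N | (i <= j)%N)
                  (g i j)%:R * (spin s i * spin s j))
        + B * \sum_(i < N) spin s i).

Definition partition_function g (beta B : R) : R := \sum_s boltzmann g beta B s.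

Definition ising g (beta B : R) s : R :=
  boltzmann g beta B s / partition_function g beta B.

Definition ising_mean g (beta B : R) (f : {ffun 'I_N -> bool} -> R) : R :=
  \sum_s ising g beta B s * f s.

Definition ising_prob g (beta B : R) (A : pred {ffun 'I_N -> bool}) : R :=
  \sum_(s | A s) ising g beta B s.

Definition magnetization_N g (beta B : R) : R :=
  ising_mean g beta B (fun s => total_spin s / N%:R).

End Ising.

(* [M] is the (nonrandom) almost sure limit M(beta, B) of M_N(beta, B). *)
Definition is_magnetization {R : realType} {d : measure_display}
    {Omega : measurableType d} (P : probability Omega R)
    (G : forall N : nat, Omega -> mgraph N) (beta B M : R) : Prop :=
  {ae P, forall w, (fun N => magnetization_N (G N w) beta B) @ \oo --> M}.

(* Main.v *)
Require Import Defs.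
From HB Require Import structures.
From mathcomp Require Import all_boot all_order all_algebra.
From mathcomp Require Import all_classical all_reals all_analysis.
From mathcomp Require Import ring lra.

Set Implicit Arguments.
Unset Strict Implicit.
Unset Printing Implicit Defensive.
Import Order.TTheory GRing.Theory Num.Theory.
Import numFieldNormedType.Exports.

Local Open Scope classical_set_scope.
Local Open Scope ring_scope.

(** Everything reduces to a one-sided continuity of the finite-volume
    magnetization. By Chernoff's bound and Jensen's inequality, for every t > 0
    the probability that S_N / N >= M + eps is at most
    exp (N t (M_N (beta, B + t) - M - eps)), and symmetrically below
    ([chernoff], [ising_tail]). It is therefore enough to find, for each eta, a
    fixed t > 0 such that M_N (beta, B + t) <= M_N (beta, B) + eta and
    M_N (beta, B - t) >= M_N (beta, B) - eta for all large N.

    Both regimes rest on one correlation inequality ([site_mean_concave]): in a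
    ferromagnet with nonnegative external fields, the mean of a spin satisfies
      m (c + k + k') + m c <= m (c + k) + m (c + k')
    for c, k, k' >= 0. This is an integrated form of the
    Griffiths-Hurst-Sherman inequality, and it is proved by the four-replica
    method: after the orthogonal change of variables [walsh] in the four
    copies, the total energy is a polynomial with nonnegative coefficients in
    the rotated spins, the difference of the two sides is the mean of a single
    rotated spin, and all the moments of the rotated spins at one site are
    nonnegative.

    If B > 0, the inequality says that B |-> M_N (beta, B) is concave on a
    lattice of fields through 0; as it vanishes at 0 and is at most 1, its
    increments at B are small uniformly in N and in the graph
    ([magnetization_right_left]). The case B < 0 follows by flipping the spins.

    If B = 0 and beta < beta_c, then M_N (beta, 0) = 0 and one has to bound
    M_N (beta, h) for a small field h > 0. With c = 0 the same inequality is a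
    subadditivity in the fields; used in the gauge where the spin at i is +1,
    it gives the self-avoiding walk bound [site_mean_le],
      <s_i> <= tanh h + sum_v tanh (beta m_iv) <s_v>_(vertex i isolated),
    with m_iv the number of edges between i and v. Unfolded inside a
    neighbourhood that is a tree T of depth t, it gives the recursive bound
    [tree_bound] on T. For the limiting branching process the expected bound is
    at most tanh h + tanh beta E[D] (tanh h / (1 - r) + r^(t-1)) with
    r = nu tanh beta < 1 ([bp_tree_bound], [gw_tree_bound]): it is small when t
    is large and h is small depending on t. Local convergence is then applied
    to finitely many trees that carry almost all the mass of the branching
    process, and the trivial bound <s_i> <= 1 handles the other vertices. *)

(** * Moments of four rotated spins at one site *)

Section SingleSite.
Variable R : realType.
Definition sgn (b : bool) : R := if b then 1 else -1.

(** Twice the orthogonal change of variables of the four-replica method. The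
    sign of the last row is chosen so that the product of the four rotated
    variables is never negative on spins. *)
Definition walsh (r : 'I_4) (x1 x2 x3 x4 : R) : R :=
  match val r with
  | 0 => x1 + x2 + x3 + x4
  | 1 => x1 + x2 - x3 - x4
  | 2 => x1 - x2 + x3 - x4
  | _ => - x1 + x2 + x3 - x4
  end.

(** The sixteen spin patterns split in two: with an even number of minus signs,
    one rotated variable is 4 or -4 and the others vanish; with an odd number,
    all are 2 or -2, and exactly the sign patterns with positive product occur.
    A moment of the first kind is nonnegative by symmetry, and the second kind
    is a sum of characters over a group of order 8. *)
Lemma walsh_moment_ge0 (e : 'I_4 -> nat) :
  0 <= \sum_b1 \sum_b2 \sum_b3 \sum_b4
         \prod_r walsh r (sgn b1) (sgn b2) (sgn b3) (sgn b4) ^+ e r.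
Proof.
rewrite !big_bool !big_ord_recl !big_ord0 /walsh /=.
move: (e _) (e _) (e _) (e _) => a b c d.
rewrite !mulr1 !opprK.
have W0 : (1 + 1 + 1 + 1 = 4 :> R) by ring.
have W1 : (1 + 1 + 1 - 1 = 2 :> R) by ring.
have W2 : (1 + 1 - 1 + 1 = 2 :> R) by ring.
have W3 : (1 + 1 - 1 - 1 = 0 :> R) by ring.
have W4 : (1 - 1 + 1 + 1 = 2 :> R) by ring.
have W5 : (1 - 1 + 1 - 1 = 0 :> R) by ring.
have W6 : (1 - 1 - 1 + 1 = 0 :> R) by ring.
have W7 : (1 - 1 - 1 - 1 = -2 :> R) by ring.
have W8 : (-1 + 1 + 1 + 1 = 2 :> R) by ring.
have W9 : (-1 + 1 + 1 - 1 = 0 :> R) by ring.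
have W10 : (-1 + 1 - 1 + 1 = 0 :> R) by ring.
have W11 : (-1 + 1 - 1 - 1 = -2 :> R) by ring.
have W12 : (-1 - 1 + 1 + 1 = 0 :> R) by ring.
have W13 : (-1 - 1 + 1 - 1 = -2 :> R) by ring.
have W14 : (-1 - 1 - 1 + 1 = -2 :> R) by ring.
have W15 : (-1 - 1 - 1 - 1 = -4 :> R) by ring.
rewrite !(W0, W1, W2, W3, W4, W5, W6, W7, W8, W9, W10, W11, W12, W13, W14, W15).
have -> : -4 = -1 * 4 :> R by ring.
have -> : -2 = -1 * 2 :> R by ring.
rewrite !exprMn !expr0n -(signr_odd _ a) -(signr_odd _ b) -(signr_odd _ c) -(signr_odd _ d).
have sgn01 (o : bool) : 0 <= 1 + (-1) ^+ o :> R by case: o; rewrite ?expr0 ?expr1; lra.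
have pos4 n : 0 <= 4 ^+ n :> R by rewrite exprn_ge0.
have pos2 n : 0 <= 2 ^+ n :> R by rewrite exprn_ge0.
set za : R := (a == 0%N)%:R; set zb : R := (b == 0%N)%:R.
set zc : R := (c == 0%N)%:R; set zd : R := (d == 0%N)%:R.
have [za0 zb0 zc0 zd0] : [/\ 0 <= za, 0 <= zb, 0 <= zc & 0 <= zd] by split; exact: ler0n.
set sa : R := (-1) ^+ odd a; set sb : R := (-1) ^+ odd b.
set sc : R := (-1) ^+ odd c; set sd : R := (-1) ^+ odd d.
(* The sum of the character with these exponents over the sign patterns of
   positive product: 8 if all the exponents have the same parity, else 0. *)
have parity : 0 <= 1 + sa * sb + sa * sc + sa * sd + sb * sc + sb * sd
    + sc * sd + sa * sb * sc * sd.
  by rewrite /sa /sb /sc /sd; case: (odd a); case: (odd b); case: (odd c);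
    case: (odd d); rewrite ?expr0 ?expr1; lra.
set S := (X in 0 <= X).
have -> : S =
    (1 + sa) * (4 ^+ a * (zb * zc * zd)) + (1 + sb) * (4 ^+ b * (za * zc * zd))
  + (1 + sc) * (4 ^+ c * (za * zb * zd)) + (1 + sd) * (4 ^+ d * (za * zb * zc))
  + (1 + sa * sb + sa * sc + sa * sd + sb * sc + sb * sd
    + sc * sd + sa * sb * sc * sd) * (2 ^+ a * 2 ^+ b * 2 ^+ c * 2 ^+ d).
  by rewrite /S; ring.
by rewrite !addr_ge0 // ?mulr_ge0 // ?sgn01 // ?mulr_ge0 // mulr_ge0.
Qed.
End SingleSite.
(** * The positive cone of the four-replica method *)

Section Multipliers.
Variables (R : realType) (N : nat).
Notation conf := {ffun 'I_N -> bool}.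
Notation conf4 := (conf * conf * conf * conf)%type.

Lemma sum_conf4 (F : conf4 -> R) :
  \sum_w F w = \sum_s1 \sum_s2 \sum_s3 \sum_s4 F (s1, s2, s3, s4).
Proof.
have sum_prod (A A' : finType) (H : A * A' -> R) :
    \sum_w H w = \sum_a \sum_a' H (a, a').
  by rewrite pair_bigA; apply: eq_bigr => -[].
by rewrite sum_prod sum_prod sum_prod.
Qed.

Definition rotated (r : 'I_4) (x : 'I_N) (w : conf4) : R :=
  walsh r (spin w.1.1.1 x) (spin w.1.1.2 x) (spin w.1.2 x) (spin w.2 x).

Definition rotated_monomial (e : 'I_N -> 'I_4 -> nat) (w : conf4) : R :=
  \prod_x \prod_r rotated r x w ^+ e x r.

(** Nonnegativity against all monomials in the rotated spins, not only in total:
    this is what makes the property stable under multiplication by a rotated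
    spin. *)
Definition replica_pos (F : conf4 -> R) : Prop :=
  forall e, 0 <= \sum_w F w * rotated_monomial e w.

(** Multipliers form a cone closed under sums, products and exponentials, in
    which positivity can be read off the generators. *)
Definition multiplier (G : conf4 -> R) : Prop :=
  forall F, replica_pos F -> replica_pos (fun w => F w * G w).

(** The uniform measure on four copies is a product over sites, so its
    rotated moments are products of those of [walsh_moment_ge0]. *)
Lemma replica_pos1 : replica_pos (fun=> 1).
Proof.
move=> e; rewrite sum_conf4.
set Q := fun (x : 'I_N) b1 b2 b3 b4 =>
  \prod_r walsh r (sgn R b1) (sgn R b2) (sgn R b3) (sgn R b4) ^+ e x r.
suff -> : \sum_s1 \sum_s2 \sum_s3 \sum_s4
    1 * rotated_monomial e (s1, s2, s3, s4) =
    \prod_x \sum_b1 \sum_b2 \sum_b3 \sum_b4 Q x b1 b2 b3 b4.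
  by apply: prodr_ge0 => x _; exact: walsh_moment_ge0.
rewrite bigA_distr_bigA; apply: eq_bigr => s1 _.
rewrite bigA_distr_bigA; apply: eq_bigr => s2 _.
rewrite bigA_distr_bigA; apply: eq_bigr => s3 _.
rewrite bigA_distr_bigA; apply: eq_bigr => s4 _.
by rewrite mul1r.
Qed.

Lemma multiplier_eq (G H : conf4 -> R) : G =1 H -> multiplier G -> multiplier H.
Proof.
move=> GH mG F posF e; have := mG F posF e.
by under eq_bigr do rewrite GH.
Qed.

Lemma multiplierD (G H : conf4 -> R) :
  multiplier G -> multiplier H -> multiplier (fun w => G w + H w).
Proof.
move=> mG mH F posF e.
under eq_bigr do rewrite mulrDr mulrDl.
by rewrite big_split addr_ge0 ?mG ?mH.
Qed.

Lemma multiplierM (G H : conf4 -> R) :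
  multiplier G -> multiplier H -> multiplier (fun w => G w * H w).
Proof.
move=> mG mH F posF e.
have := mH _ (mG _ posF) e.
by under eq_bigr do rewrite -(mulrA (F _)).
Qed.

Lemma multiplier_cst (c : R) : 0 <= c -> multiplier (fun=> c).
Proof.
move=> c0 F posF e.
under eq_bigr do rewrite (mulrC (F _)) -mulrA.
by rewrite -mulr_sumr mulr_ge0 ?posF.
Qed.

Lemma multiplier_sum (I : Type) (r : seq I) (Q : pred I) (G : I -> conf4 -> R) :
  (forall i, Q i -> multiplier (G i)) ->
  multiplier (fun w => \sum_(i <- r | Q i) G i w).
Proof.
move=> mG; elim: r => [|i r IH].
  by apply: multiplier_eq (multiplier_cst (lexx 0)) => w; rewrite big_nil.
case: (boolP (Q i)) => Qi.
  apply: multiplier_eq (multiplierD (mG i Qi) IH) => w.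
  by rewrite big_cons Qi.
by apply: multiplier_eq IH => w; rewrite big_cons (negbTE Qi).
Qed.

Lemma multiplierX (G : conf4 -> R) n :
  multiplier G -> multiplier (fun w => G w ^+ n).
Proof.
move=> mG; elim: n => [|n IH].
  by apply: multiplier_eq (multiplier_cst ler01) => w; rewrite expr0.
by apply: multiplier_eq (multiplierM mG IH) => w; rewrite exprS.
Qed.

Lemma multiplier_rotated r x : multiplier (rotated r x).
Proof.
move=> F posF e.
have := posF (fun y q => (e y q + ((y == x) && (q == r)))%N).
congr (0 <= _); apply: eq_bigr => w _; rewrite -mulrA; congr (_ * _).
rewrite /rotated_monomial.
under eq_bigr => y _ do under eq_bigr => q _ do rewrite exprD.
under eq_bigr => y _ do rewrite big_split.
rewrite big_split /= mulrC; congr (_ * _).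
rewrite (bigD1 x) //= (bigD1 r) //= !eqxx expr1 big1 => [|q /negbTE ->].
  rewrite mulr1 big1 ?mulr1 // => y /negbTE -> /=.
  by rewrite big1 // => q _; rewrite expr0.
by rewrite andbF expr0.
Qed.

(** The partial sums of the exponential series are multipliers, and an inequality
    passes to the limit because the sum over configurations is finite. *)
Lemma multiplier_expR (G : conf4 -> R) :
  multiplier G -> multiplier (fun w => expR (G w)).
Proof.
move=> mG F posF e.
have cvgF : (fun n => \sum_w F w * series (exp_coeff (G w)) n * rotated_monomial e w)
    @ \oo --> \sum_w F w * expR (G w) * rotated_monomial e w.
  apply: (cvg_big add_continuous) => w _; apply: cvgMl; apply: cvgMr.
  exact: is_cvg_series_exp_coeff.
apply: (cvgr_to_ge cvgF).
apply: nearW => n.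
suff: multiplier (fun w => series (exp_coeff (G w)) n) by exact.
apply: multiplier_sum => k _.
apply: multiplierM; first exact: multiplierX.
by apply: multiplier_cst; rewrite invr_ge0.
Qed.

End Multipliers.

Arguments rotated {R N} r x w.
(** * Gibbs means and concavity in the field *)

Section GibbsMean.
Variables (R : realType) (N : nat).
Notation conf := {ffun 'I_N -> bool}.
Implicit Types (E F : conf -> R) (s : conf) (h : 'I_N -> R) (J : 'I_N -> 'I_N -> R).

Definition gibbs_sum E : R := \sum_s expR (E s).
Definition gibbs_mean E F : R := (\sum_s F s * expR (E s)) / gibbs_sum E.

Lemma gibbs_sum_gt0 E : 0 < gibbs_sum E.
Proof.
rewrite /gibbs_sum (bigD1 [ffun=> true]) //= ltr_wpDr ?expR_gt0 //.
by apply: sumr_ge0 => s _; rewrite expR_ge0.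
Qed.

Lemma gibbs_sum_neq0 E : gibbs_sum E != 0.
Proof. by rewrite gt_eqF ?gibbs_sum_gt0. Qed.

Lemma eq_gibbs_mean E E' F F' :
  E =1 E' -> F =1 F' -> gibbs_mean E F = gibbs_mean E' F'.
Proof.
move=> eE eF; rewrite /gibbs_mean /gibbs_sum; congr (_ / _).
  by apply: eq_bigr => s _; rewrite eE eF.
by apply: eq_bigr => s _; rewrite eE.
Qed.

Lemma gibbs_mean_cst E (c : R) : gibbs_mean E (fun=> c) = c.
Proof. by rewrite /gibbs_mean -mulr_sumr mulfK ?gibbs_sum_neq0. Qed.

Lemma ler_gibbs_mean E F F' :
  (forall s, F s <= F' s) -> gibbs_mean E F <= gibbs_mean E F'.
Proof.
move=> leF; rewrite ler_pM2r ?invr_gt0 ?gibbs_sum_gt0 //.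
by apply: ler_sum => s _; rewrite ler_pM2r ?expR_gt0.
Qed.

Lemma gibbs_meanN E F : gibbs_mean E (fun s => - F s) = - gibbs_mean E F.
Proof.
rewrite /gibbs_mean -mulNr -sumrN; congr (_ / _).
by apply: eq_bigr => s _; rewrite mulNr.
Qed.

Lemma gibbs_meanZ E F c : gibbs_mean E (fun s => c * F s) = c * gibbs_mean E F.
Proof.
rewrite /gibbs_mean mulrA mulr_sumr; congr (_ / _).
by apply: eq_bigr => s _; rewrite mulrA.
Qed.

Lemma gibbs_mean_sum (I : Type) (r : seq I) E (F : I -> conf -> R) :
  gibbs_mean E (fun s => \sum_(i <- r) F i s) = \sum_(i <- r) gibbs_mean E (F i).
Proof.
rewrite /gibbs_mean -mulr_suml exchange_big /=; congr (_ / _).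
by apply: eq_bigr => s _; rewrite mulr_suml.
Qed.

Lemma gibbs_mean_reindex (f : conf -> conf) E F : involutive f ->
  gibbs_mean E F = gibbs_mean (E \o f) (F \o f).
Proof.
move=> fK; rewrite /gibbs_mean /gibbs_sum.
by rewrite (reindex_inj (inv_inj fK)) [in X in _ / X](reindex_inj (inv_inj fK)).
Qed.

Lemma spin_sq s i : spin s i * spin s i = 1 :> R.
Proof. by rewrite /spin; case: (s i); rewrite ?mulrNN mulr1. Qed.

Definition flip s : conf := [ffun x => ~~ s x].

Lemma flipK : involutive flip.
Proof. by move=> s; apply/ffunP => x; rewrite !ffunE negbK. Qed.

Lemma spin_flip s x : spin (flip s) x = - spin s x :> R.
Proof. by rewrite /spin ffunE; case: (s x) => //=; rewrite opprK. Qed.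

Lemma sum_odd_eq0 F : (forall s, F (flip s) = - F s) -> \sum_s F s = 0.
Proof.
move=> oddF; have : \sum_s F s = - \sum_s F s.
  rewrite {1}(reindex_inj (inv_inj flipK)) -sumrN.
  by apply: eq_bigr => s _; rewrite oddF.
by move=> H; lra.
Qed.

Definition field_energy h s : R := \sum_x h x * spin s x.
Definition pair_energy J s : R := \sum_x \sum_y J x y * (spin s x * spin s y).

Definition even_energy E := forall s, E (flip s) = E s.

Lemma even_pair_energy J : even_energy (pair_energy J).
Proof.
move=> s; apply: eq_bigr => x _; apply: eq_bigr => y _.
by rewrite !spin_flip mulrNN.
Qed.

(** The hyperbolic tangent. *)
Definition th (k : R) : R := (expR k - expR (- k)) / (expR k + expR (- k)).

Lemma th_den_gt0 k : 0 < expR k + expR (- k) :> R.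
Proof. by rewrite addr_gt0 ?expR_gt0. Qed.

Lemma expR_spin (k : R) s v :
  expR (k * spin s v) = (expR k + expR (- k)) / 2 * (1 + th k * spin s v).
Proof.
rewrite /th /spin; move: (th_den_gt0 k).
by case: (s v) => d0; rewrite ?mulrN1 ?mulr1; field; exact: lt0r_neq0.
Qed.

(** Since exp (k s) = cosh k (1 + s tanh k) for a spin s, a field at one site
    multiplies numerator and denominator by the same cosh k, up to sums that
    vanish by symmetry under a global flip. *)
Lemma gibbs_mean_site_even E F v (k : R) :
  even_energy E -> (forall s, F (flip s) = F s) ->
  gibbs_mean (fun s => E s + k * spin s v) F = gibbs_mean E F.
Proof.
move=> evE evF; rewrite /gibbs_mean /gibbs_sum.
set C := (expR k + expR (- k)) / 2.
have C0 : C != 0 by rewrite mulf_neq0 ?lt0r_neq0 ?th_den_gt0 // invr_gt0.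
have factor G : (forall s, G (flip s) = G s) ->
    \sum_s G s * expR (E s + k * spin s v) = C * \sum_s G s * expR (E s).
  move=> evG; transitivity (C * \sum_s G s * expR (E s) +
                C * th k * \sum_s G s * expR (E s) * spin s v).
    rewrite !mulr_sumr -big_split; apply: eq_bigr => s _ /=.
    by rewrite expRD expR_spin -/C; ring.
  rewrite [X in _ + _ * X]sum_odd_eq0 ?mulr0 ?addr0 // => s.
  by rewrite evG evE spin_flip mulrN.
have -> : \sum_s expR (E s + k * spin s v) = C * \sum_s expR (E s).
  by have := factor (fun=> 1) (fun=> erefl); under eq_bigr do rewrite mul1r;
    under [in X in _ = _ * X]eq_bigr do rewrite mul1r.
by rewrite factor // -mulf_div divff ?mul1r.
Qed.

Lemma gibbs_mean_site_odd E i v (k : R) : even_energy E ->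
  gibbs_mean (fun s => E s + k * spin s v) (fun s => spin s i) =
  th k * gibbs_mean E (fun s => spin s i * spin s v).
Proof.
move=> evE; rewrite /gibbs_mean /gibbs_sum.
set C := (expR k + expR (- k)) / 2.
have C0 : C != 0 by rewrite mulf_neq0 ?lt0r_neq0 ?th_den_gt0 // invr_gt0.
have -> : \sum_s spin s i * expR (E s + k * spin s v) =
    C * (th k * \sum_s spin s i * spin s v * expR (E s)).
  transitivity (C * \sum_s spin s i * expR (E s) +
      C * (th k * \sum_s spin s i * spin s v * expR (E s))).
    rewrite !mulr_sumr -big_split; apply: eq_bigr => s _ /=.
    by rewrite expRD expR_spin -/C; ring.
  rewrite sum_odd_eq0 ?mulr0 ?add0r // => s.
  by rewrite evE spin_flip mulNr.
have -> : \sum_s expR (E s + k * spin s v) = C * \sum_s expR (E s).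
  transitivity (C * \sum_s expR (E s) + C * th k * \sum_s expR (E s) * spin s v).
    rewrite !mulr_sumr -big_split; apply: eq_bigr => s _ /=.
    by rewrite expRD expR_spin -/C; ring.
  rewrite [X in _ + _ * X]sum_odd_eq0 ?mulr0 ?addr0 // => s.
  by rewrite evE spin_flip mulrN.
by rewrite -mulf_div divff // mul1r mulrA.
Qed.

(** Stated for the sum over four copies, as this is the only way in which the
    energy enters the replica argument. *)
Definition ferromagnetic E :=
  multiplier (fun w => E w.1.1.1 + E w.1.1.2 + E w.1.2 + E w.2).

(** The rotation is orthogonal, so the sum over copies of s_x s_y is again the
    sum over rotated spins, up to the factor 4 of the normalization. *)
Lemma ferromagnetic_pair (c : R) x y : 0 <= c ->
  ferromagnetic (fun s => c * (spin s x * spin s y)).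
Proof.
move=> c0; rewrite /ferromagnetic; refine (@multiplier_eq _ _ (fun w =>
    c / 4 * \sum_r rotated r x w * rotated r y w) _ _ _) => [w|].
  by rewrite !big_ord_recl big_ord0 /rotated /walsh /=; field.
apply: multiplierM; first by apply: multiplier_cst; rewrite divr_ge0.
by apply: multiplier_sum => r _; apply: multiplierM; exact: multiplier_rotated.
Qed.

Lemma ferromagneticD E E' : ferromagnetic E -> ferromagnetic E' ->
  ferromagnetic (fun s => E s + E' s).
Proof.
by move=> fE fE'; rewrite /ferromagnetic; apply: multiplier_eq (multiplierD fE fE') => w /=; ring.
Qed.

Lemma ferromagnetic_sum (I : finType) (Q : pred I) (E : I -> conf -> R) :
  (forall i, Q i -> ferromagnetic (E i)) ->
  ferromagnetic (fun s => \sum_(i | Q i) E i s).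
Proof.
move=> fE; rewrite /ferromagnetic; apply: multiplier_eq (multiplier_sum (index_enum I) fE) => w /=.
by rewrite !big_split.
Qed.

Lemma ferromagnetic_pair_energy J : (forall x y, 0 <= J x y) ->
  ferromagnetic (pair_energy J).
Proof.
move=> J0; apply: ferromagnetic_sum => x _; apply: ferromagnetic_sum => y _.
exact: ferromagnetic_pair.
Qed.

Lemma multiplier_sum_ge0 (G : conf * conf * conf * conf -> R) :
  multiplier G -> 0 <= \sum_w G w.
Proof.
move=> mG; have := mG _ (@replica_pos1 R N) (fun _ _ => 0%N).
congr (0 <= _); apply: eq_bigr => w _.
by rewrite mul1r /rotated_monomial big1 ?mulr1 // => x _; rewrite big1.
Qed.

Definition site_mean E h (a : 'I_N) : R :=
  gibbs_mean (fun s => E s + field_energy h s) (fun s => spin s a).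

(** In the rotated variables, the fields f1, f2, f3, f4 of the four copies have
    coefficients (f2 + f3) / 2, (f2 - f4) / 2, (f3 - f4) / 2 and 0, all
    nonnegative. The mean of the last rotated spin is thus nonnegative, and it is
    - m f1 + m f2 + m f3 - m f4. *)
Lemma site_mean_concave E (f1 f2 f3 f4 : 'I_N -> R) (a : 'I_N) :
  ferromagnetic E -> (forall x, 0 <= f4 x) ->
  (forall x, f4 x <= f2 x) -> (forall x, f4 x <= f3 x) ->
  (forall x, f1 x + f4 x = f2 x + f3 x) ->
  site_mean E f1 a + site_mean E f4 a <= site_mean E f2 a + site_mean E f3 a.
Proof.
move=> fE f40 f42 f43 f1E; pose m f := site_mean E f a.
change (m f1 + m f4 <= m f2 + m f3).
pose U f s := E s + field_energy f s.
pose z f := gibbs_sum (U f); pose n f := \sum_s spin s a * expR (U f s).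
have mE f : m f = n f / z f by [].
have z0 f : 0 < z f by exact: gibbs_sum_gt0.
pose W (w : conf * conf * conf * conf) :=
  U f1 w.1.1.1 + U f2 w.1.1.2 + U f3 w.1.2 + U f4 w.2.
have mW : multiplier W.
  refine (@multiplier_eq _ _ (fun w =>
      E w.1.1.1 + E w.1.1.2 + E w.1.2 + E w.2 +
      \sum_x ((f2 x + f3 x) / 2 * rotated 0 x w
              + (f2 x - f4 x) / 2 * rotated 1 x w
              + (f3 x - f4 x) / 2 * rotated 2 x w)) _ _ _) => [w|].
    rewrite /W /U /field_energy.
    transitivity (E w.1.1.1 + E w.1.1.2 + E w.1.2 + E w.2 +
      \sum_x (f1 x * spin w.1.1.1 x + f2 x * spin w.1.1.2 x
              + f3 x * spin w.1.2 x + f4 x * spin w.2 x)).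
      congr (_ + _); apply: eq_bigr => x _.
      have -> : f1 x = f2 x + f3 x - f4 x by rewrite -f1E addrK.
      by rewrite /rotated /walsh /=; field.
    by rewrite !big_split /=; ring.
  apply: multiplierD => //; apply: multiplier_sum => x _.
  have f20 := le_trans (f40 x) (f42 x); have f30 := le_trans (f40 x) (f43 x).
  apply: multiplierD; first apply: multiplierD.
  - by apply: multiplierM (multiplier_rotated _ _); apply: multiplier_cst;
      rewrite divr_ge0 ?addr_ge0.
  - by apply: multiplierM (multiplier_rotated _ _); apply: multiplier_cst;
      rewrite divr_ge0 ?subr_ge0.
  - by apply: multiplierM (multiplier_rotated _ _); apply: multiplier_cst;
      rewrite divr_ge0 ?subr_ge0.
have := multiplier_sum_ge0
  (multiplierM (multiplier_rotated 3 a) (multiplier_expR mW)).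
have -> : \sum_w rotated 3 a w * expR (W w) =
    - (n f1 * z f2 * z f3 * z f4) + z f1 * n f2 * z f3 * z f4
    + z f1 * z f2 * n f3 * z f4 - z f1 * z f2 * z f3 * n f4.
  have prod4 (g1 g2 g3 g4 : conf -> R) :
      \sum_(w : conf * conf * conf * conf) g1 w.1.1.1 * g2 w.1.1.2 * g3 w.1.2 * g4 w.2 =
      (\sum_s g1 s) * (\sum_s g2 s) * (\sum_s g3 s) * (\sum_s g4 s).
    rewrite sum_conf4 /= !mulr_suml; apply: eq_bigr => s1 _.
    rewrite [g1 s1 * _]mulr_sumr !mulr_suml; apply: eq_bigr => s2 _.
    rewrite [g1 s1 * _ * _]mulr_sumr !mulr_suml; apply: eq_bigr => s3 _.
    by rewrite mulr_sumr.
  rewrite /n /z /gibbs_sum -!prod4 -sumrN -!sumrN -!big_split.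
  apply: eq_bigr => w _; rewrite /W !expRD /rotated /walsh /=; ring.
have -> : - (n f1 * z f2 * z f3 * z f4) + z f1 * n f2 * z f3 * z f4
    + z f1 * z f2 * n f3 * z f4 - z f1 * z f2 * z f3 * n f4
    = (m f2 + m f3 - (m f1 + m f4)) * (z f1 * z f2 * z f3 * z f4).
  by rewrite !mE; field; rewrite !gt_eqF.
by rewrite pmulr_lge0 ?subr_ge0 // !mulr_gt0.
Qed.

End GibbsMean.
(** * The self-avoiding walk bound *)

Section SelfAvoiding.
Variables (R : realType) (N : nat).
Notation conf := {ffun 'I_N -> bool}.
Implicit Types (E F : conf -> R) (s : conf) (h : 'I_N -> R) (J : 'I_N -> 'I_N -> R).

Lemma th_ge0 (k : R) : 0 <= k -> 0 <= th k.
Proof.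
move=> k0; rewrite divr_ge0 ?(ltW (th_den_gt0 _)) // subr_ge0 ler_expR.
by lra.
Qed.

Lemma th0 : th (0 : R) = 0.
Proof. by rewrite /th oppr0 subrr mul0r. Qed.

Lemma thE (k : R) : th k = 1 - 2 / (expR (2 * k) + 1).
Proof.
have -> : 2 * k = k + k by ring.
rewrite /th expRD expRN; have := expR_gt0 k; move: (expR k) => e e0.
field; rewrite ?gt_eqF ?addr_gt0 ?mulr_gt0 //.
Qed.

Lemma th_lt1 (k : R) : th k < 1.
Proof.
have := expR_gt0 (2 * k) => e0.
by rewrite thE gtrBl divr_gt0 ?addr_gt0.
Qed.

Lemma ler_th (k k' : R) : k <= k' -> th k <= th k'.
Proof.
move=> kk'; rewrite !thE lerD2l lerN2 ler_pM2l // lef_pV2 ?posrE ?addr_gt0 ?expR_gt0 //.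
by rewrite lerD2r ler_expR ler_pM2l.
Qed.

Lemma th_le2 (k : R) : 0 <= k -> th k <= 2 * k.
Proof.
move=> k0; have e1 := expR_ge1Dx (- (2 * k)).
have -> : th k = (1 - expR (- (2 * k))) / (1 + expR (- (2 * k))).
  rewrite thE expRN; have := expR_gt0 (2 * k); move: (expR _) => e e0.
  by field; rewrite ?gt_eqF ?addr_gt0 ?mulr_gt0 ?invr_gt0 //.
have e0 := expR_gt0 (- (2 * k)).
rewrite ler_pdivrMr ?addr_gt0 //; nra.
Qed.

Lemma site_mean0 E a : even_energy E -> site_mean E (fun=> 0) a = 0.
Proof.
move=> evE; rewrite /site_mean /gibbs_mean sum_odd_eq0 ?mul0r // => s.
rewrite spin_flip evE mulNr; congr (- (_ * expR (_ + _))).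
by apply: eq_bigr => x _; rewrite !mul0r.
Qed.

Lemma eq_site_mean E h h' a : h =1 h' -> site_mean E h a = site_mean E h' a.
Proof.
move=> eqh; apply: eq_gibbs_mean => // s; congr (_ + _).
by apply: eq_bigr => x _; rewrite eqh.
Qed.

(** With f4 = 0 in [site_mean_concave] the mean of a spin is subadditive in the
    field, so the field may be switched on one site at a time, and a field at a
    single site is computed exactly. *)
Lemma site_mean_subadditive E h a : ferromagnetic E -> even_energy E ->
  (forall x, 0 <= h x) ->
  site_mean E h a <=
    \sum_v th (h v) * gibbs_mean E (fun s => spin s a * spin s v).
Proof.
move=> fE evE h0.
pose hr (r : seq 'I_N) x := \sum_(v <- r) (if x == v then h v else 0).
have hr0 r x : 0 <= hr r x by apply: sumr_ge0 => v _; case: ifP.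
have step r : site_mean E (hr r) a <=
    \sum_(v <- r) th (h v) * gibbs_mean E (fun s => spin s a * spin s v).
  elim: r => [|v r IH].
    rewrite big_nil -(site_mean0 a evE) (@eq_site_mean _ _ (fun=> 0)) // => x.
    by rewrite /hr big_nil.
  rewrite big_cons -gibbs_mean_site_odd //.
  have := @site_mean_concave R N E (hr (v :: r))
    (fun x => if x == v then h v else 0) (hr r) (fun=> 0) a fE (fun=> lexx 0).
  rewrite site_mean0 // addr0 => concave.
  apply: le_trans (concave _ _ _) _ => [x|//|x|].
  - by case: ifP.
  - by rewrite addr0 /hr big_cons.
  rewrite lerD // le_eqVlt; apply/orP; left; apply/eqP.
  apply: eq_gibbs_mean => // s; congr (_ + _).
  rewrite /field_energy (bigD1 v) //= eqxx big1 ?addr0 // => x /negbTE ->.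
  by rewrite mul0r.
apply: le_trans (step (index_enum 'I_N)).
rewrite (@eq_site_mean _ h (hr (index_enum 'I_N))) // => x.
by rewrite /hr -big_mkcond /= (big_pred1 x) // => v; rewrite eq_sym.
Qed.

(** Vertex i is disconnected rather than deleted: the vertex set, hence the type
    of configurations, does not change along the recursion. The self-coupling of
    i, a constant in the energy, stays so that the gauge identities are exact. *)
Definition isolate (i : 'I_N) J x y : R :=
  if (x == i) (+) (y == i) then 0 else J x y.

Lemma pair_energy_isolate i J s :
  pair_energy J s = pair_energy (isolate i J) s
    + spin s i * \sum_(x | x != i) (J i x + J x i) * spin s x.
Proof.
rewrite /pair_energy (bigD1 i) //= [in RHS](bigD1 i) //=.
rewrite (bigD1 i) //= [\sum_y isolate i J i y * _](bigD1 i) //=.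
rewrite [X in _ = _ + X + _ + _]big1 ?addr0; last first.
  by move=> y /negbTE yi; rewrite /isolate eqxx yi mul0r.
rewrite {1}/isolate eqxx /= -!addrA; congr (_ + _).
rewrite mulr_sumr.
transitivity (\sum_(x | x != i) (J i x * (spin s i * spin s x) +
    (J x i * (spin s x * spin s i) +
     \sum_(y | y != i) J x y * (spin s x * spin s y)))).
  rewrite big_split; congr (_ + _); apply: eq_bigr => x xi.
  by rewrite [LHS](bigD1 i).
rewrite -big_split; apply: eq_bigr => x xi /=.
rewrite [\sum_y isolate _ _ _ _ * _](bigD1 i) //= /isolate (negbTE xi) eqxx /=.
rewrite mul0r add0r.
rewrite [X in _ = X + _](eq_bigr (fun y => J x y * (spin s x * spin s y))).
  by ring.
by move=> y /negbTE ->.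
Qed.

(** Expresses the other spins relative to the one at i. This exchanges the roles
    of i and of the external field: couplings at i become fields, and fields
    become couplings to i. *)
Definition gauge (i : 'I_N) s : conf :=
  [ffun x => if x == i then s i else s x == s i].

Lemma gaugeK i : involutive (gauge i).
Proof.
move=> s; apply/ffunP => x; rewrite !ffunE eqxx.
by case: eqP => [->//|_]; case: (s x); case: (s i).
Qed.

Lemma spin_gauge i s x :
  spin (gauge i s) x = (if x == i then spin s i else spin s x * spin s i) :> R.
Proof.
rewrite /spin ffunE; case: eqP => // _.
by case: (s x); case: (s i); rewrite /= ?mulrNN ?mulr1 ?mul1r.
Qed.

Lemma pair_energy_gauge i J s :
  pair_energy (isolate i J) (gauge i s) = pair_energy (isolate i J) s.
Proof.
apply: eq_bigr => x _; apply: eq_bigr => y _; rewrite /isolate !spin_gauge.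
case: eqP => [->|_]; case: eqP => [->|_] //=; rewrite ?mul0r //.
by rewrite mulrACA spin_sq mulr1.
Qed.

(** In the gauge of i, the couplings J i v + J v i and the field h i act as an
    external field on an even ferromagnet E, in which the field h survives as a
    coupling to the spin at i. Subadditivity splits that external field, and the
    gauge transformation turns the two-point function of i and v in E back into
    the mean of the spin at v when i is isolated. *)
Lemma site_mean_le J h i :
  (forall x y, 0 <= J x y) -> (forall x, 0 <= h x) ->
  site_mean (pair_energy J) h i <= th (h i) +
    \sum_(v | v != i) th (J i v + J v i) * site_mean (pair_energy (isolate i J)) h v.
Proof.
move=> J0 h0.
pose E s := pair_energy (isolate i J) s
            + \sum_(x | x != i) h x * (spin s i * spin s x).
pose k x := if x == i then h i else J i x + J x i.
have evE : even_energy E.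
  move=> s; rewrite /E even_pair_energy; congr (_ + _).
  by apply: eq_bigr => x _; rewrite !spin_flip mulrNN.
have fE : ferromagnetic E.
  apply: ferromagneticD.
    by apply: ferromagnetic_pair_energy => x y; rewrite /isolate; case: ifP.
  by apply: ferromagnetic_sum => x _; exact: ferromagnetic_pair.
have k0 x : 0 <= k x by rewrite /k; case: ifP => // _; rewrite addr_ge0.
have field_gauge s : field_energy h (gauge i s) =
    \sum_(x | x != i) h x * (spin s i * spin s x) + h i * spin s i.
  rewrite /field_energy (bigD1 i) //= spin_gauge eqxx addrC; congr (_ + _).
  by apply: eq_bigr => x /negbTE xi; rewrite spin_gauge xi [spin s x * _]mulrC.
have -> : site_mean (pair_energy J) h i = site_mean E k i.
  rewrite /site_mean (gibbs_mean_reindex _ _ (gaugeK i)).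
  apply: eq_gibbs_mean => s /=; last by rewrite spin_gauge eqxx.
  rewrite (pair_energy_isolate i) pair_energy_gauge field_gauge /E.
  have -> : field_energy k s = h i * spin s i + \sum_(x | x != i) k x * spin s x.
    by rewrite /field_energy (bigD1 i) //= /k eqxx.
  rewrite spin_gauge eqxx.
  rewrite (_ : spin s i * _ = \sum_(x | x != i) k x * spin s x); first by ring.
  rewrite mulr_sumr; apply: eq_bigr => x /negbTE xi.
  rewrite spin_gauge /k xi.
  transitivity ((J i x + J x i) * spin s x * (spin s i * spin s i)); first by ring.
  by rewrite spin_sq mulr1.
apply: le_trans (site_mean_subadditive i fE evE k0) _.
rewrite (bigD1 i) //= {1}/k eqxx.
rewrite (@eq_gibbs_mean _ _ E E (fun s => spin s i * spin s i) (fun=> 1)) //; last first.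
  by move=> s; rewrite spin_sq.
rewrite gibbs_mean_cst mulr1 lerD2l; apply: ler_sum => v vi.
rewrite /k (negbTE vi) (_ : gibbs_mean E _ = site_mean (pair_energy (isolate i J)) h v) //.
rewrite -(@gibbs_mean_site_even _ _ E (fun s => spin s i * spin s v) i (h i) evE).
  2: by move=> s; rewrite !spin_flip mulrNN.
rewrite /site_mean [RHS](gibbs_mean_reindex _ _ (gaugeK i)).
apply: eq_gibbs_mean => s /=; last first.
  by rewrite spin_gauge (negbTE vi) mulrC.
by rewrite pair_energy_gauge field_gauge /E addrA.
Qed.

End SelfAvoiding.
(** * Exponential tails and one-sided increments of the magnetization *)

Section LargeDeviations.
Variables (R : realType) (N : nat).
Notation conf := {ffun 'I_N -> bool}.
Implicit Types (E X : conf -> R) (g : mgraph N) (beta B : R).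

(** Jensen's inequality for the tilted measure E + t X, in the form
    exp u >= 1 + u applied to the centred variable. *)
Lemma gibbs_sum_tilt_le E X (t : R) :
  gibbs_sum (fun s => E s + t * X s) <=
  gibbs_sum E * expR (t * gibbs_mean (fun s => E s + t * X s) X).
Proof.
set E' := fun s => E s + t * X s; set m := gibbs_mean E' X.
have -> : gibbs_sum E = \sum_s expR (E' s) * expR (- (t * X s)).
  by apply: eq_bigr => s _; rewrite -expRD addrK.
have -> : gibbs_sum E' = \sum_s expR (E' s) * (1 - t * (X s - m)).
  have mZ : m * gibbs_sum E' = \sum_s X s * expR (E' s).
    by rewrite /m /gibbs_mean -mulrA mulVf ?gibbs_sum_neq0 // mulr1.
  transitivity (gibbs_sum E' - t * (\sum_s X s * expR (E' s) - m * gibbs_sum E')).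
    by rewrite mZ subrr mulr0 subr0.
  rewrite /gibbs_sum (mulr_sumr _ _ _ m) -sumrB mulr_sumr -sumrB.
  by apply: eq_bigr => s _; ring.
rewrite mulr_suml; apply: ler_sum => s _.
rewrite -mulrA ler_pM2l ?expR_gt0 // -expRD.
rewrite (_ : - (t * X s) + t * m = - (t * (X s - m))); last by ring.
exact: expR_ge1Dx.
Qed.

Lemma chernoff E X (a t : R) : 0 <= t ->
  (\sum_(s | a <= X s) expR (E s)) / gibbs_sum E <=
  expR (t * (gibbs_mean (fun s => E s + t * X s) X - a)).
Proof.
move=> t0; rewrite ler_pdivrMr ?gibbs_sum_gt0 //.
apply: (@le_trans _ _ (gibbs_sum (fun s => E s + t * X s) * expR (- (t * a)))).
  rewrite /gibbs_sum mulr_suml big_mkcond /=; apply: ler_sum => s _.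
  case: ifP => aX; last by rewrite mulr_ge0 ?expR_ge0.
  by rewrite -expRD ler_expR -addrA lerDl subr_ge0 ler_wpM2l.
apply: le_trans (ler_wpM2r (expR_ge0 _) (gibbs_sum_tilt_le E X t)) _.
rewrite -mulrA -expRD mulrC ler_wpM2r ?(ltW (gibbs_sum_gt0 _)) //.
by rewrite mulrBr.
Qed.

(** Each pair is counted once, on the side x <= y; the walk bound only
    sees J x y + J y x. *)
Definition coupling g (beta : R) (x y : 'I_N) : R :=
  if (x <= y)%N then beta * (g x y)%:R else 0.

Lemma coupling_ge0 g beta : 0 <= beta -> forall x y, 0 <= coupling g beta x y.
Proof. by move=> b0 x y; rewrite /coupling; case: ifP => // _; rewrite mulr_ge0. Qed.

Definition ising_energy g (beta B : R) (s : conf) : R :=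
  pair_energy (coupling g beta) s + field_energy (fun=> B) s.

Lemma boltzmannE g beta B s : boltzmann g beta B s = expR (ising_energy g beta B s).
Proof.
rewrite /boltzmann /ising_energy.
have -> : field_energy (fun=> B) s = B * \sum_x spin s x.
  by rewrite mulr_sumr.
rewrite (_ : beta * _ = pair_energy (coupling g beta) s) //.
rewrite mulr_sumr; apply: eq_bigr => i _.
rewrite big_mkcond mulr_sumr; apply: eq_bigr => j _.
by rewrite /coupling; case: ifP => _; [rewrite mulrA | rewrite mul0r mulr0].
Qed.

Lemma partition_functionE g beta B :
  partition_function g beta B = gibbs_sum (ising_energy g beta B).
Proof. by apply: eq_bigr => s _; rewrite boltzmannE. Qed.

Lemma magnetization_gibbs g beta B :
  magnetization_N g beta B =
  gibbs_mean (ising_energy g beta B) (fun s => total_spin s / N%:R).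
Proof.
rewrite /magnetization_N /ising_mean /gibbs_mean mulr_suml.
apply: eq_bigr => s _; rewrite /ising boltzmannE partition_functionE.
by rewrite mulrC mulrA.
Qed.

Lemma magnetizationE g beta B :
  magnetization_N g beta B =
  (\sum_i site_mean (pair_energy (coupling g beta)) (fun=> B) i) / N%:R.
Proof.
rewrite magnetization_gibbs -[in RHS]gibbs_mean_sum mulrC -gibbs_meanZ.
by apply: eq_gibbs_mean => // s; rewrite mulrC.
Qed.

Lemma magnetization0 g beta : magnetization_N g beta 0 = 0.
Proof.
rewrite magnetizationE big1 ?mul0r // => i _.
by rewrite site_mean0 //; exact: even_pair_energy.
Qed.

Lemma magnetizationN g beta B : magnetization_N g beta (- B) = - magnetization_N g beta B.
Proof.
rewrite !magnetization_gibbs -gibbs_meanN (gibbs_mean_reindex _ _ (@flipK N)).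
apply: eq_gibbs_mean => s /=.
  rewrite /ising_energy even_pair_energy; congr (_ + _).
  by apply: eq_bigr => x _; rewrite spin_flip mulrNN.
rewrite -mulNr -sumrN; congr (_ / _).
by apply: eq_bigr => x _; rewrite spin_flip.
Qed.

Lemma site_mean_le1 (E : conf -> R) h a : site_mean E h a <= 1.
Proof.
rewrite -[X in _ <= X](gibbs_mean_cst (fun s => E s + field_energy h s)).
apply: ler_gibbs_mean => s; rewrite /spin; case: ifP => // _; lra.
Qed.

Lemma magnetization_le1 g beta B : magnetization_N g beta B <= 1.
Proof.
rewrite magnetizationE; have [N0|N0] := posnP N.
  by rewrite (_ : N%:R = 0) ?invr0 ?mulr0 ?ler01 // N0.
rewrite ler_pdivrMr ?ltr0n // mul1r.
apply: le_trans (ler_sum _ (fun i _ => site_mean_le1 _ _ _)) _.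
by rewrite sumr_const card_ord.
Qed.

Lemma magnetization_concave g beta (B1 B2 B3 B4 : R) : 0 <= beta ->
  0 <= B4 -> B4 <= B2 -> B4 <= B3 -> B1 + B4 = B2 + B3 ->
  magnetization_N g beta B1 + magnetization_N g beta B4 <=
  magnetization_N g beta B2 + magnetization_N g beta B3.
Proof.
move=> b0 B40 B42 B43 BE; rewrite !magnetizationE -!mulrDl.
rewrite ler_wpM2r ?invr_ge0 // -!big_split; apply: ler_sum => i _.
apply: site_mean_concave => //.
by apply: ferromagnetic_pair_energy; exact: coupling_ge0.
Qed.

(** Along the fields 0, t, 2 t, ... the increments decrease and add up to at most
    1, so the n-th one is at most 1 / n. *)
Lemma magnetization_increment g beta (t : R) n : 0 <= beta -> 0 <= t ->
  n.+1%:R * (magnetization_N g beta (n.+1%:R * t) - magnetization_N g beta (n%:R * t))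
  <= 1.
Proof.
move=> b0 t0; set m := fun k : nat => magnetization_N g beta (k%:R * t).
suff H : n.+1%:R * (m n.+1 - m n) <= m n.+1.
  exact: le_trans H (magnetization_le1 _ _ _).
elim: n => [|n IH].
  by rewrite mul1r /m mul0r magnetization0 subr0.
have conc : m n.+2 + m n <= m n.+1 + m n.+1.
  apply: magnetization_concave => //; rewrite ?mulr_ge0 ?ler_wpM2r ?ler_nat //.
  by rewrite -!mulrDl -!natrD !addSn !addnS.
have -> : n.+2%:R = n.+1%:R + 1 :> R by rewrite -natr1.
have n0 : 0 <= n.+1%:R :> R by [].
nra.
Qed.

(** Each one-sided tail is at most exp (- N t eps / 2); halving the rate absorbs
    the factor 2 as soon as N t eps / 4 >= 1. *)
Lemma ising_tail g beta B (M t eps : R) : 0 <= t -> 0 < eps ->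
  1 <= N%:R * (t * eps / 4) ->
  magnetization_N g beta (B + t) <= M + eps / 2 ->
  M - eps / 2 <= magnetization_N g beta (B - t) ->
  ising_prob g beta B (fun s => eps <= `|total_spin s / N%:R - M|)
    <= expR (- (N%:R * (t * eps / 4))).
Proof.
move=> t0 e0 Nlarge up down.
have N0 : 0 < N%:R :> R.
  by rewrite lt0r ler0n andbT; apply: contraL Nlarge => /eqP ->; rewrite mul0r -ltNge ltr01.
pose E := ising_energy g beta B.
have tiltP (u : R) X c : (forall s, X s = c * (total_spin s / N%:R)) ->
    gibbs_mean (fun s => E s + u * N%:R * X s) X =
    c * magnetization_N g beta (B + c * u).
  move=> XE; rewrite magnetization_gibbs -gibbs_meanZ.
  apply: eq_gibbs_mean => // s; rewrite XE /E /ising_energy /field_energy /total_spin.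
  rewrite -addrA; congr (_ + _); rewrite -!mulr_sumr.
  by field; rewrite gt_eqF.
have half (X : conf -> R) c : (forall s, X s = c * (total_spin s / N%:R)) ->
    c * magnetization_N g beta (B + c * t) <= c * M + eps / 2 ->
    (\sum_(s | c * M + eps <= X s) expR (E s)) / gibbs_sum E
      <= expR (- (N%:R * (t * eps / 2))).
  move=> XE ub.
  have tN0 : 0 <= t * N%:R by rewrite mulr_ge0.
  apply: le_trans (chernoff E X (c * M + eps) tN0) _.
  rewrite ler_expR (tiltP _ _ c) //.
  have -> : - (N%:R * (t * eps / 2)) = t * N%:R * (- (eps / 2)) by ring.
  by rewrite ler_wpM2l //; lra.
have Hup := half (fun s => 1 * (total_spin s / N%:R)) 1 (fun=> erefl).
have Hdn := half (fun s => -1 * (total_spin s / N%:R)) (-1) (fun=> erefl).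
rewrite !mul1r in Hup; rewrite !mulN1r in Hdn.
have {}Hup := Hup up.
have {}Hdn := Hdn _; rewrite -subr_ge0 opprK in Hdn.
have {}Hdn : (\sum_(s | - M + eps <= -1 * (total_spin s / N%:R)) expR (E s))
    / gibbs_sum E <= expR (- (N%:R * (t * eps / 2))) by apply: Hdn; lra.
apply: (@le_trans _ _ (2 * expR (- (N%:R * (t * eps / 2))))).
  have -> (x : R) : 2 * x = x + x by ring.
  apply: le_trans (lerD Hup Hdn).
  rewrite /ising_prob -mulrDl /ising -mulr_suml partition_functionE.
  rewrite ler_pM2r ?invr_gt0 ?gibbs_sum_gt0 //.
  rewrite big_mkcond [X in _ <= X + _]big_mkcond [X in _ <= _ + X]big_mkcond.
  rewrite -big_split /=; apply: ler_sum => s _; rewrite boltzmannE -/E.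
  have eE := expR_ge0 (E s).
  case: (boolP (eps <= _)) => [|_]; last by do 2 case: ifP => _; rewrite ?addr0 ?add0r ?addr_ge0.
  rewrite ler_normr => /orP far.
  case: ifP => [_|/negbT]; first by rewrite lerDl; case: ifP.
  rewrite -ltNge mul1r => up'; case: ifP => [_|/negbT]; first by rewrite add0r.
  by rewrite -ltNge mulN1r => dn'; exfalso; case: far; lra.
have -> : N%:R * (t * eps / 2) = N%:R * (t * eps / 4) + N%:R * (t * eps / 4) by field.
rewrite opprD expRD mulrA -[X in _ <= X]mul1r ler_wpM2r ?expR_ge0 //.
rewrite expRN ler_pdivrMr ?expR_gt0 // mul1r.
by apply: le_trans (expR_ge1Dx _); lra.
Qed.

End LargeDeviations.

(** Here t is B / n for n large: B itself is then a point of the lattice of fields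
    in [magnetization_increment], far enough from 0. *)
Lemma magnetization_right_left (R : realType) (beta B eta : R) :
  0 <= beta -> B != 0 -> 0 < eta ->
  exists2 t : R, 0 < t & forall N (g : mgraph N),
    magnetization_N g beta (B + t) <= magnetization_N g beta B + eta /\
    magnetization_N g beta B - eta <= magnetization_N g beta (B - t).
Proof.
move=> b0; wlog B0 : B / 0 < B => [wl|] Bn0 eta0.
  case: (ltrgtP B 0) => [Bneg|Bpos|Beq0]; last by rewrite Beq0 eqxx in Bn0.
    have [||t t0 H] := wl (- B) _ _ eta0; rewrite ?oppr_gt0 ?oppr_eq0 //.
    exists t => // N g; have [up dn] := H N g.
    have EB : magnetization_N g beta (- B) = - magnetization_N g beta B.
      exact: magnetizationN.
    have E1 : magnetization_N g beta (- B + t) = - magnetization_N g beta (B - t).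
      by rewrite -magnetizationN; congr magnetization_N; ring.
    have E2 : magnetization_N g beta (- B - t) = - magnetization_N g beta (B + t).
      by rewrite -magnetizationN; congr magnetization_N; ring.
    by move: up dn; rewrite EB E1 E2; split; lra.
  exact: wl.
have [n n_large] : exists n : nat, eta^-1 <= n.+1%:R.
  exists (Num.truncn eta^-1); apply: ltW; exact: truncnS_gt.
have m0 : 0 < n.+2%:R :> R by [].
pose t := B / n.+2%:R.
have t0 : 0 < t by rewrite divr_gt0.
exists t => // N g.
have BE : B = n.+2%:R * t by rewrite /t mulrCA divff ?mulr1 // gt_eqF.
have small k (x : R) : (n.+1 <= k)%N -> k%:R * x <= 1 -> x <= eta.
  move=> nk kx; rewrite leNgt; apply/negP => ex.
  have k_eta : 1 <= k%:R * eta.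
    rewrite -[X in X <= _](mulVf (lt0r_neq0 eta0)) ler_pM2r //.
    by apply: le_trans n_large _; rewrite ler_nat.
  have k0 : 0 < k%:R :> R by rewrite ltr0n (leq_ltn_trans _ nk).
  by move: kx; apply/negP; rewrite -ltNge (le_lt_trans k_eta) // ltr_pM2l.
split.
  have := small n.+3 _ _ (magnetization_increment g n.+2 b0 (ltW t0)).
  rewrite (_ : n.+3%:R * t = B + t); last by rewrite BE -natr1; ring.
  by rewrite -BE => /(_ (leqW (leqnSn _))); lra.
have := small n.+2 _ _ (magnetization_increment g n.+1 b0 (ltW t0)).
rewrite -BE (_ : n.+1%:R * t = B - t); last by rewrite BE -[n.+2%:R]natr1; ring.
by move=> /(_ (leqnSn _)); lra.
Qed.
(** * Spin means in tree-like neighbourhoods *)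

Section TreeBound.
Variable R : realType.

(** Here a stands for tanh B and theta for tanh beta; the value 1 at depth m is
    the trivial bound on a spin, that is, plus boundary conditions. *)
Fixpoint tree_bound (a theta : R) (m : nat) (T : ptree) : R :=
  if m is m'.+1 then
    a + theta * \sum_(T' <- children T) tree_bound a theta m' T'
  else 1.

Lemma tree_bound_ge0 a theta m T : 0 <= a -> 0 <= theta ->
  0 <= tree_bound a theta m T.
Proof.
move=> a0 th0; elim: m T => [|m IH] T /=; first exact: ler01.
by rewrite addr_ge0 // mulr_ge0 // sumr_ge0.
Qed.

Fixpoint subtree (T : ptree) (u : seq nat) : ptree :=
  if u is k :: u' then subtree (nth T (children T) k) u' else T.

Lemma subtree_rcons T u k :
  subtree T (rcons u k) = nth (subtree T u) (children (subtree T u)) k.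
Proof. by elim: u T => [//|j u IH] T /=; rewrite IH. Qed.

Lemma address_rcons T u k :
  address T (rcons u k) = address T u && (k < size (children (subtree T u)))%N.
Proof. by elim: u T => [|j u IH] T /=; rewrite ?andbT // IH andbA. Qed.

Lemma child_ofP u v : reflect (exists k, v = rcons u k) (child_of u v).
Proof.
apply: (iffP idP) => [|[k ->]]; last first.
  by rewrite /child_of size_rcons eqxx andbT prefix_rcons.
case/andP => /prefixP[s ->]; rewrite size_cat -addn1 eqn_add2l.
by case: s => [//|k [|//]] _; exists k; rewrite cats1.
Qed.

Lemma ball_verts_step N (g : mgraph N) (i v w : 'I_N) n :
  ball_verts g i n v -> (0 < g v w)%N -> ball_verts g i n.+1 w.
Proof.
move=> [s [ps ls ss]] gvw; exists (rcons s w); split.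
- by rewrite rcons_path ps ls.
- by rewrite last_rcons.
- by rewrite size_rcons.
Qed.

Lemma ball_vertsW N (g : mgraph N) (i v : 'I_N) m n : (m <= n)%N ->
  ball_verts g i m v -> ball_verts g i n v.
Proof. by move=> mn [s [ps ls ss]]; exists s; split=> //; exact: leq_trans mn. Qed.

(** The isomorphism f is used to walk down the tree: below the vertex v, the sum
    over neighbours in the walk bound runs over the children of f v only, because
    the parent has been isolated before. All other information on the couplings J
    left after isolating the vertices of a branch is that they are dominated by
    those of g. *)
Lemma site_mean_le_tree N (g : mgraph N) (i : 'I_N) (t : nat) (T : ptree) (beta B : R) :
  0 <= beta -> 0 <= B -> rg_iso (nbhd g i t) (tree_graph T) ->
  site_mean (pair_energy (coupling g beta)) (fun=> B) i
    <= tree_bound (th B) (th beta) t T.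
Proof.
move=> b0 B0 [f [fbij fi fmult]]; rewrite /= in fbij fi fmult.
have [fim finj _] := fbij.
have thb := th_ge0 b0; have thB := th_ge0 B0.
suff H m v J : (size (f v) + m = t)%N -> ball_verts g i (size (f v)) v ->
    (forall x y, 0 <= J x y) ->
    (forall x y, x != y -> J x y + J y x <= beta * (g x y)%:R) ->
    (forall w, ball_verts g i t w -> child_of (f w) (f v) -> J v w + J w v = 0) ->
    site_mean (pair_energy J) (fun=> B) v
      <= tree_bound (th B) (th beta) m (subtree T (f v)).
  have -> : T = subtree T (f i) by rewrite fi.
  apply: H.
  - by rewrite fi.
  - by rewrite fi; exists [::]; split.
  - exact: coupling_ge0.
  - move=> x y; rewrite /coupling -val_eqE /= [g y x]multC.
    by case: (ltngtP x y) => //= _ _; rewrite ?addr0 ?add0r.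
  - by move=> w _; rewrite fi => /child_ofP[k]; case: (f w).
elim: m v J => [|m IH] v J tE vball J0 Jg Jparent; first exact: site_mean_le1.
have vt : ball_verts g i t v by apply: ball_vertsW vball; rewrite -tE leq_addr.
apply: le_trans (site_mean_le _ J0 (fun=> B0)) _ => /=.
rewrite lerD2l.
set T' := subtree T (f v); pose b k := tree_bound (th B) (th beta) m (nth T' (children T') k).
have bge0 k : 0 <= b k by exact: tree_bound_ge0.
have tb0 k : 0 <= th beta * b k by exact: mulr_ge0.
have -> : th beta * \sum_(T1 <- children T') tree_bound (th B) (th beta) m T1
    = \sum_(k < size (children T')) th beta * b k.
  by rewrite mulr_sumr (big_nth T') big_mkord.
(* w is the k-th child of v; restricting to the ball makes w unique, as f is
   injective only there. *)
pose hit (w : 'I_N) (k : nat) := `[< ball_verts g i t w /\ f w = rcons (f v) k >].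
apply: (@le_trans _ _ (\sum_(w | w != v) \sum_(k < size (children T'))
    if hit w k then th beta * b k else 0)); last first.
  rewrite exchange_big /=; apply: ler_sum => k _.
  have [[w /asboolP[wt fw]]|nohit] := pselect (exists w, hit w k); last first.
    rewrite big1 ?tb0 // => w _.
    by case: ifP => // Hw; exfalso; apply: nohit; exists w.
  rewrite big_mkcond (bigD1 w) //= [X in _ + X]big1 ?addr0.
    by do 2 case: ifP => _ //.
  move=> w' w'w; case: ifP => // _; case: ifP => // /asboolP[w't fw'].
  exfalso; move/eqP: w'w; apply.
  exact: (finj _ _ (mem_set w't) (mem_set wt) (etrans fw' (esym fw))).
apply: ler_sum => w wv.
have rhs0 : 0 <= \sum_(k < size (children T')) if hit w k then th beta * b k else 0.
  by apply: sumr_ge0 => k _; case: ifP.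
have Jvw0 : 0 <= J v w + J w v by rewrite addr_ge0.
have zero : J v w + J w v = 0 ->
    th (J v w + J w v) * site_mean (pair_energy (isolate v J)) (fun=> B) w <=
    \sum_(k < size (children T')) if hit w k then th beta * b k else 0.
  by move=> ->; rewrite th0 mul0r.
have vw : v != w by rewrite eq_sym.
have [gvw|gvw] := posnP (g v w).
  by apply: zero; apply/eqP; rewrite eq_le Jvw0 andbT; have := Jg _ _ vw; rewrite gvw mulr0.
have wS : ball_verts g i (size (f v)).+1 w by exact: ball_verts_step gvw.
have wt : ball_verts g i t w.
  by apply: ball_vertsW wS; rewrite -tE addnS ltnS leq_addr.
have := fmult v w vt wt => /= adj.
have [par|npar] := boolP (child_of (f w) (f v)); first exact/zero/Jparent.
have gvw1 : g v w = 1%N by rewrite -adj in gvw *; move: gvw; case: (_ || _).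
have : child_of (f v) (f w) by move: adj; rewrite (negbTE npar) orbF gvw1; case: child_of.
case/child_ofP => k fw.
have : address T (f w) by have := fim w wt.
rewrite fw address_rcons => /andP[_ kn].
have bound : site_mean (pair_energy (isolate v J)) (fun=> B) w <= b k.
  rewrite /b -/T' -subtree_rcons -fw; apply: IH.
  - by rewrite fw size_rcons addSnnS.
  - by rewrite fw size_rcons.
  - by move=> x y; rewrite /isolate; case: ifP.
  - move=> x y xy; rewrite /isolate [in X in _ + X]addbC.
    by case: ifP => _; [rewrite addr0 mulr_ge0|exact: Jg].
  - move=> w' w't /child_ofP[k']; rewrite fw => /rcons_inj[fvw' _].
    have -> : w' = v by exact: (finj _ _ (mem_set w't) (mem_set vt) (esym fvw')).
    by rewrite /isolate eqxx (negbTE wv) /= addr0.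
apply: (@le_trans _ _ (th beta * b k)); last first.
  have hwk : hit w k by exact/asboolP.
  rewrite (bigD1 (Ordinal kn)) //= hwk lerDl sumr_ge0 // => k' _.
  by case: ifP.
apply: (@le_trans _ _ (th (J v w + J w v) * b k)); first by rewrite ler_wpM2l ?th_ge0.
by rewrite ler_wpM2r // ler_th //; have := Jg _ _ vw; rewrite gvw1 mulr1.
Qed.

End TreeBound.
(** * The branching process restricted to finitely many trees *)

Section BoundedTrees.
Variable R : realType.
Implicit Types (q rho w b : nat -> R).

Fixpoint seqs_of (A : Type) (k : nat) (L : seq A) : seq (seq A) :=
  if k is k'.+1 then [seq x :: s | x <- L, s <- seqs_of k' L] else [:: [::]].

Lemma size_seqs_of (A : eqType) k (L : seq A) s : s \in seqs_of k L -> size s = k.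
Proof.
elim: k s => [|k IH] s /=; first by rewrite inE => /eqP ->.
by case/allpairsP => -[x s'] /= [_ /IH <- ->].
Qed.

Lemma mem_seqs_of (A : eqType) k (L : seq A) s : s \in seqs_of k L ->
  {subset s <= L}.
Proof.
elim: k s => [|k IH] s /=; first by rewrite inE => /eqP -> x.
case/allpairsP => -[x s'] /= [xL /IH sL ->] y; rewrite inE.
by case/predU1P => [->|/sL].
Qed.

Lemma uniq_seqs_of (A : eqType) k (L : seq A) : uniq L -> uniq (seqs_of k L).
Proof.
move=> uL; elim: k => [//|k IH] /=; apply: allpairs_uniq => //.
by move=> [x s] [y s'] _ _ /= [-> ->].
Qed.

Lemma sum_seqs_of_prod (A : Type) k (L : seq A) (f : A -> R) :
  \sum_(s <- seqs_of k L) \prod_(x <- s) f x = (\sum_(x <- L) f x) ^+ k.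
Proof.
elim: k => [|k IH] /=; first by rewrite big_seq1 big_nil expr0.
rewrite big_allpairs_dep exprS big_distrl /=; apply: eq_bigr => x _.
rewrite -IH mulr_sumr; apply: eq_bigr => s _.
by rewrite big_cons.
Qed.

Lemma sum_seqs_of_prod_sum (A : Type) k (L : seq A) (f b : A -> R) :
  (forall x, 0 <= f x) -> (forall x, 0 <= b x) -> \sum_(x <- L) f x <= 1 ->
  \sum_(s <- seqs_of k L) (\prod_(x <- s) f x) * (\sum_(x <- s) b x)
    <= k%:R * \sum_(x <- L) f x * b x.
Proof.
move=> f0 b0 f1; have S0 : 0 <= \sum_(x <- L) f x by apply: sumr_ge0.
have M0 : 0 <= \sum_(x <- L) f x * b x by apply: sumr_ge0 => x _; exact: mulr_ge0.
elim: k => [|k IH] /=; first by rewrite big_seq1 !big_nil mulr0 mul0r.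
rewrite big_allpairs_dep.
have -> : \sum_(x <- L) \sum_(s <- seqs_of k L)
      (\prod_(y <- x :: s) f y) * (\sum_(y <- x :: s) b y) =
    (\sum_(x <- L) f x * b x) * (\sum_(x <- L) f x) ^+ k +
    (\sum_(x <- L) f x) *
      \sum_(s <- seqs_of k L) (\prod_(x <- s) f x) * (\sum_(x <- s) b x).
  rewrite !mulr_suml -big_split; apply: eq_bigr => x _ /=.
  rewrite -sum_seqs_of_prod !mulr_sumr -big_split; apply: eq_bigr => s _ /=.
  by rewrite !big_cons; ring.
rewrite -natr1 mulrDl mul1r addrC lerD //; last by rewrite ler_piMr ?exprn_ile1.
apply: le_trans IH; rewrite ler_piMl // sumr_ge0 // => s _.
by rewrite mulr_ge0 ?prodr_ge0 ?sumr_ge0.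
Qed.

(** All plane trees of depth at most m with fewer than K children at each vertex:
    sums over this list replace expectations of the branching process. *)
Fixpoint bounded_trees (K m : nat) : seq ptree :=
  if m is m'.+1 then
    [seq PNode s | k <- iota 0 K, s <- seqs_of k (bounded_trees K m')]
  else [:: PNode [::]].

Lemma bounded_trees_uniq K m : uniq (bounded_trees K m).
Proof.
elim: m => [//|m IH] /=; apply: allpairs_uniq_dep.
- exact: iota_uniq.
- by move=> k _; exact: uniq_seqs_of.
- move=> [k s] [k' s'] /allpairsPdep[l [u [_ lu [-> ->]]]].
  case/allpairsPdep => l' [u' [_ lu' [-> ->]]] /= [uu'].
  by rewrite uu' in lu *; rewrite -(size_seqs_of lu) -(size_seqs_of lu').
Qed.

Lemma bounded_trees_depth K m T : T \in bounded_trees K m -> depth_le m T.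
Proof.
elim: m T => [|m IH] T /=; first by rewrite inE => /eqP ->.
case/allpairsPdep => k [s [_ /mem_seqs_of sL ->]] /=.
by apply/allP => T' /sL /IH.
Qed.

(** For a summable law the two properties below say that the total mass is 1; kept
    apart, they are finite statements about partial sums. *)
Definition sub_law q :=
  (forall k, 0 <= q k) /\ (forall K, \sum_(0 <= k < K) q k <= 1).

Definition full_mass q := forall e : R, 0 < e ->
  exists K0, forall K, (K0 <= K)%N -> 1 - e <= \sum_(0 <= k < K) q k.

Lemma gw_weight_ge0 rho m T : (forall k, 0 <= rho k) -> 0 <= gw_weight rho m T.
Proof.
move=> rho0; elim: m T => [|m IH] T /=; first exact: ler0n.
by rewrite mulr_ge0 // prodr_ge0.
Qed.

Lemma bp_weight_ge0 q rho m T : (forall k, 0 <= q k) -> (forall k, 0 <= rho k) ->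
  0 <= bp_weight q rho m T.
Proof.
move=> q0 rho0; case: m => [|m] /=; first exact: ler0n.
by rewrite mulr_ge0 // prodr_ge0 // => T' _; exact: gw_weight_ge0.
Qed.

Lemma sum_bounded_trees K m (f : ptree -> R) :
  \sum_(T <- bounded_trees K m.+1) f T =
  \sum_(0 <= k < K) \sum_(s <- seqs_of k (bounded_trees K m)) f (PNode s).
Proof. by rewrite /= big_allpairs_dep /index_iota subn0. Qed.

Definition gw_mass rho K m : R := \sum_(T <- bounded_trees K m) gw_weight rho m T.

Lemma bp_massE q rho K m :
  \sum_(T <- bounded_trees K m.+1) bp_weight q rho m.+1 T =
  \sum_(0 <= k < K) q k * gw_mass rho K m ^+ k.
Proof.
rewrite sum_bounded_trees; apply: eq_bigr => k _.
rewrite -sum_seqs_of_prod mulr_sumr big_seq [RHS]big_seq.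
by apply: eq_bigr => s /size_seqs_of <-.
Qed.

Lemma gw_massS rho K m :
  gw_mass rho K m.+1 = \sum_(0 <= k < K) rho k * gw_mass rho K m ^+ k.
Proof. exact: (bp_massE rho rho K m). Qed.

Lemma gw_mass0 rho K : gw_mass rho K 0 = 1.
Proof. by rewrite /gw_mass big_seq1. Qed.

Lemma gw_mass_ge0 rho K m : (forall k, 0 <= rho k) -> 0 <= gw_mass rho K m.
Proof. by move=> rho0; apply: sumr_ge0 => T _; exact: gw_weight_ge0. Qed.

Lemma mass_step_le1 q K (x : R) : sub_law q -> 0 <= x <= 1 ->
  \sum_(0 <= k < K) q k * x ^+ k <= 1.
Proof.
move=> [q0 q1] /andP[x0 x1]; apply: le_trans (q1 K); apply: ler_sum => k _.
by rewrite ler_piMr ?exprn_ile1.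
Qed.

Lemma gw_mass_le1 rho K m : sub_law rho -> gw_mass rho K m <= 1.
Proof.
move=> law; elim: m => [|m IH]; first by rewrite gw_mass0.
rewrite gw_massS mass_step_le1 // IH andbT gw_mass_ge0 //.
by case: law.
Qed.

(** If subtrees have mass x close to 1, then by Bernoulli's inequality so do the
    sequences of at most K0 subtrees, and K0 children suffice with high
    probability. *)
Lemma mass_step_near1 q : sub_law q -> full_mass q ->
  forall e : R, 0 < e -> exists K0, exists2 d : R, 0 < d &
    forall K x, (K0 <= K)%N -> 1 - d <= x <= 1 -> 0 <= x ->
      1 - e <= \sum_(0 <= k < K) q k * x ^+ k.
Proof.
move=> [q0 q1] full e e0.
have [K0 HK0] := full (e / 2) (divr_gt0 e0 (ltr0n _ 2)).
exists K0; exists (e / 2 / K0.+1%:R); first by rewrite !divr_gt0.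
move=> K x KK /andP[dx x1] x0.
have bern n : 1 - n%:R * (1 - x) <= x ^+ n.
  elim: n => [|n IH]; first by rewrite mul0r subr0 expr0.
  rewrite exprS -natr1.
  have xn1 : x ^+ n <= 1 by rewrite exprn_ile1.
  nra.
apply: (@le_trans _ _ (\sum_(0 <= k < K0) q k * x ^+ k)); last first.
  rewrite (big_cat_nat (leq0n _) KK) //= lerDl sumr_ge0 // => k _.
  by rewrite mulr_ge0 ?exprn_ge0.
apply: (@le_trans _ _ (\sum_(0 <= k < K0) q k * (1 - e / 2))).
  rewrite -mulr_suml; have := HK0 K0 (leqnn _); have := q1 K0.
  by set S := \sum_(_ <= _ < _) _ => S1 Se; nra.
rewrite !big_nat; apply: ler_sum => k /andP[_ kK].
rewrite ler_wpM2l //; apply: le_trans (bern k).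
rewrite lerD2l lerN2.
apply: (@le_trans _ _ (K0.+1%:R * (e / 2 / K0.+1%:R))); last first.
  by rewrite mulrC divfK.
apply: ler_pM => //; first by rewrite subr_ge0.
- by rewrite ler_nat ltnW // ltnW.
- by rewrite lerBlDr -lerBlDl.
Qed.

Lemma gw_mass_near1 rho m : sub_law rho -> full_mass rho ->
  forall e : R, 0 < e -> exists K0, forall K, (K0 <= K)%N -> 1 - e <= gw_mass rho K m.
Proof.
move=> law full; elim: m => [|m IH] e e0.
  by exists 0%N => K _; rewrite gw_mass0 gerBl ltW.
have [K0 [d d0 H]] := mass_step_near1 law full e0.
have [K1 H1] := IH d d0.
exists (maxn K0 K1) => K; rewrite geq_max => /andP[KK0 KK1].
rewrite gw_massS; apply: H => //; last by apply: gw_mass_ge0; case: law.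
by rewrite H1 //= gw_mass_le1.
Qed.

Lemma bp_mass_near1 q rho m : sub_law q -> full_mass q ->
  sub_law rho -> full_mass rho ->
  forall e : R, 0 < e -> exists K,
    1 - e <= \sum_(T <- bounded_trees K m.+1) bp_weight q rho m.+1 T.
Proof.
move=> lawq fullq law full e e0.
have [K0 [d d0 H]] := mass_step_near1 lawq fullq e0.
have [K1 H1] := gw_mass_near1 m law full d0.
exists (maxn K0 K1); rewrite bp_massE; apply: H; rewrite ?leq_maxl //.
  by rewrite H1 ?leq_maxr //= gw_mass_le1.
by apply: gw_mass_ge0; case: law.
Qed.

(** Conditionally on k children, the expected sum of the bounds of the subtrees is
    at most k times the expectation for one subtree, whence the mean mu. *)
Lemma bp_tree_bound q rho K m (a theta mu : R) :
  sub_law q -> sub_law rho -> 0 <= a -> 0 <= theta ->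
  \sum_(0 <= k < K) k%:R * q k <= mu ->
  \sum_(T <- bounded_trees K m.+1) bp_weight q rho m.+1 T * tree_bound a theta m.+1 T
  <= a + theta * mu *
     \sum_(T <- bounded_trees K m) gw_weight rho m T * tree_bound a theta m T.
Proof.
move=> lawq law a0 t0 muE; have [q0 q1] := lawq; have [rho0 rho1] := law.
set e := \sum_(T <- bounded_trees K m) _.
have e0 : 0 <= e.
  by apply: sumr_ge0 => T _; rewrite mulr_ge0 ?gw_weight_ge0 ?tree_bound_ge0.
have step k : \sum_(s <- seqs_of k (bounded_trees K m))
      bp_weight q rho m.+1 (PNode s) * tree_bound a theta m.+1 (PNode s)
    <= a * (q k * gw_mass rho K m ^+ k) + theta * e * (k%:R * q k).
  have -> : \sum_(s <- seqs_of k (bounded_trees K m))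
        bp_weight q rho m.+1 (PNode s) * tree_bound a theta m.+1 (PNode s) =
      a * (q k * gw_mass rho K m ^+ k) + theta * q k *
      \sum_(s <- seqs_of k (bounded_trees K m))
        (\prod_(T <- s) gw_weight rho m T) * (\sum_(T <- s) tree_bound a theta m T).
    rewrite -sum_seqs_of_prod !mulr_sumr -big_split big_seq [RHS]big_seq.
    apply: eq_bigr => s /size_seqs_of sk /=; rewrite sk; ring.
  rewrite lerD2l.
  apply: le_trans (ler_wpM2l _ (sum_seqs_of_prod_sum k _ _ _)) _.
  - by rewrite mulr_ge0.
  - by move=> T; exact: gw_weight_ge0.
  - by move=> T; exact: tree_bound_ge0.
  - exact: gw_mass_le1.
  - by rewrite -/e le_eqVlt; apply/orP; left; apply/eqP; ring.
rewrite sum_bounded_trees; apply: le_trans (ler_sum _ (fun k _ => step k)) _.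
rewrite big_split -!mulr_sumr /= lerD //.
  by rewrite ler_piMr // mass_step_le1 // gw_mass_ge0 //= gw_mass_le1.
by rewrite -mulrA [mu * _]mulrC mulrA ler_wpM2l // mulr_ge0.
Qed.

(** The fixed point of e |-> a + theta nu e is a / (1 - theta nu), and the initial
    value 1 is forgotten at the rate theta nu. *)
Lemma gw_tree_bound rho K m (a theta nu : R) :
  sub_law rho -> 0 <= a -> 0 <= theta -> 0 <= nu -> theta * nu < 1 ->
  (forall K, \sum_(0 <= k < K) k%:R * rho k <= nu) ->
  \sum_(T <- bounded_trees K m) gw_weight rho m T * tree_bound a theta m T
  <= a / (1 - theta * nu) + (theta * nu) ^+ m.
Proof.
move=> law a0 t0 nu0; set r := theta * nu => r1 nuE.
have r0 : 0 <= r by exact: mulr_ge0.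
elim: m => [|m IH].
  by rewrite big_seq1 /= mulr1 expr0 lerDr divr_ge0 // subr_ge0 ltW.
apply: le_trans (bp_tree_bound _ law law a0 t0 (nuE K)) _.
apply: le_trans (lerD (lexx a) (ler_wpM2l r0 IH)) _.
rewrite mulrDr -exprS addrA lerD2r le_eqVlt; apply/orP; left; apply/eqP.
by field; rewrite subr_eq0 gt_eqF.
Qed.

(** The law on isomorphism classes dominates any finite part of the law on plane
    trees. *)
Lemma bp_prob_ge q rho t T (L : seq ptree) : uniq L ->
  (forall k, 0 <= q k) -> (forall k, 0 <= rho k) ->
  ((\sum_(T' <- L | `[< rg_iso (tree_graph T') (tree_graph T) >])
      bp_weight q rho t T')%:E <= bp_prob q rho t T)%E.
Proof.
move=> uL q0 rho0; apply: esum_ge.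
exists [set` [seq T' <- L | `[< rg_iso (tree_graph T') (tree_graph T) >]]].
  split; first exact: finite_seq.
  by move=> T' /=; rewrite mem_filter => /andP[/asboolP].
rewrite -fsbig_seq ?filter_uniq // big_filter sumEFin.
by [].
Qed.

(** The root must be one of the vertices: the inverse is pinned down on the image
    of the vertices only. *)
Lemma rg_iso_sym g h : verts g (groot g) -> rg_iso g h -> rg_iso h g.
Proof.
move=> groot_in [f [fbij fr fm]].
have [_ finj fsurj] := fbij.
have preim (v : vert h) : exists u : vert g, verts h v -> verts g u /\ f u = v.
  have [hv|nhv] := pselect (verts h v); last by exists (groot g).
  by have [u gu fu] := fsurj v hv; exists u.
have [f' f'P] := choice preim.
have f'K u : verts g u -> f' (f u) = u.
  move=> gu; have fu : verts h (f u) by have [fim _ _] := fbij; exact: fim.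
  have [gu' e] := f'P _ fu.
  exact: (finj _ _ (mem_set gu') (mem_set gu) e).
exists f'; split.
- split.
  + by move=> v /f'P[].
  + move=> v v' /set_mem hv /set_mem hv' e.
    by have [_ <-] := f'P _ hv; have [_ <-] := f'P _ hv'; rewrite e.
  + move=> u gu; exists (f u); last exact: f'K.
    by have [fim _ _] := fbij; exact: fim.
- by rewrite -fr f'K.
- move=> v v' hv hv'; have [gv ev] := f'P _ hv; have [gv' ev'] := f'P _ hv'.
  by rewrite -fm // ev ev'.
Qed.

Lemma rg_iso_trans g h k : rg_iso g h -> rg_iso h k -> rg_iso g k.
Proof.
move=> [f [fbij fr fm]] [f' [fbij' fr' fm']]; exists (f' \o f); split.
- exact: set_bij_comp fbij fbij'.
- by rewrite /= fr.
- move=> u v gu gv /=; rewrite fm' ?fm //; by have [fim _ _] := fbij; exact: fim.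
Qed.

End BoundedTrees.
(** * The degree law and its size-biased law *)

Section DegreeLawFacts.
Variable R : realType.
Implicit Types (f p : nat -> R).

Lemma nneseries_real f (x : R) : (forall k, 0 <= f k) ->
  (\sum_(0 <= k <oo) (f k)%:E = x%:E)%E ->
  (forall K, \sum_(0 <= k < K) f k <= x) /\
  (forall e : R, 0 < e -> exists K0, forall K, (K0 <= K)%N ->
    x - e <= \sum_(0 <= k < K) f k).
Proof.
move=> f0 fx.
have f0E k : (0 <= (f k)%:E)%E by rewrite lee_fin.
have partial K : \sum_(0 <= k < K) f k <= x.
  by rewrite -lee_fin -fx -sumEFin; apply: nneseries_lim_ge => k _ _.
split=> // e e0.
have cv : (fun n => \sum_(0 <= k < n) (f k)%:E)%E @ \oo --> x%:E.
  by rewrite -fx; apply: is_cvg_nneseries => k _ _.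
have cvR : (fun n => \sum_(0 <= k < n) f k) @ \oo --> x.
  rewrite (_ : (fun _ => _) = fine \o (fun n => \sum_(0 <= k < n) (f k)%:E)%E).
    exact: fine_cvg.
  by apply/funext => n /=; rewrite sumEFin.
have lt_x : x - e < x by rewrite gtrBl.
have [K0 _ HK0] := cvgr_gt _ cvR _ lt_x.
by exists K0 => K K0K; apply: ltW; exact: HK0.
Qed.

Lemma degree_law_mass p : degree_law p -> sub_law p /\ full_mass p.
Proof.
by move=> [p0 _ p1 _]; have [le1 near1] := nneseries_real p0 p1; split.
Qed.

Lemma mean_degreeE p : degree_law p ->
  (\sum_(0 <= k <oo) (k%:R * p k)%:E = (mean_degree p)%:E)%E.
Proof.
move=> [p0 _ _ fin]; rewrite /mean_degree fineK // ge0_fin_numE //.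
by apply: nneseries_ge0 => k _ _; rewrite lee_fin mulr_ge0.
Qed.

Lemma mean_degree_bound p : degree_law p ->
  forall K, \sum_(0 <= k < K) k%:R * p k <= mean_degree p.
Proof.
move=> law; have [p0 _ _ _] := law.
have kp0 k : 0 <= k%:R * p k by rewrite mulr_ge0.
by have [] := nneseries_real kp0 (mean_degreeE law).
Qed.

Lemma mean_degree_gt0 p : degree_law p -> 0 < mean_degree p.
Proof.
move=> law; have [p0 p00 _ _] := law.
have [_ /(_ 2^-1)[|K /(_ K (leqnn _)) HK]] := degree_law_mass law.
  by rewrite invr_gt0.
apply: lt_le_trans (mean_degree_bound law K).
apply: (@lt_le_trans _ _ (\sum_(0 <= k < K) p k)).
  by apply: lt_le_trans HK; lra.
apply: ler_sum => -[|k] _; first by rewrite p00 mulr0.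
by rewrite ler_peMl // ler1n.
Qed.

Lemma size_biased_ge0 p : degree_law p -> forall k, 0 <= size_biased p k.
Proof.
move=> law k; have [p0 _ _ _] := law.
by rewrite divr_ge0 ?mulr_ge0 // ltW // mean_degree_gt0.
Qed.

Lemma size_biased_mass p : degree_law p ->
  sub_law (size_biased p) /\ full_mass (size_biased p).
Proof.
move=> law; have [p0 _ _ _] := law; have m0 := mean_degree_gt0 law.
have kp0 k : 0 <= k%:R * p k by rewrite mulr_ge0.
have [le_m near_m] := nneseries_real kp0 (mean_degreeE law).
have sumE K : \sum_(0 <= k < K) size_biased p k =
    (\sum_(0 <= k < K.+1) k%:R * p k) / mean_degree p.
  by rewrite big_nat_recl // mul0r add0r mulr_suml.
split; first split.
- exact: size_biased_ge0.
- by move=> K; rewrite sumE ler_pdivrMr // mul1r.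
- move=> e e0; have [K0 HK0] := near_m _ (mulr_gt0 e0 m0).
  exists K0 => K K0K; rewrite sumE ler_pdivlMr // mulrBl mul1r.
  by apply: HK0; exact: leqW.
Qed.

Lemma nu_ge0 p : degree_law p -> (0 <= nu p)%E.
Proof.
move=> law; apply: nneseries_ge0 => k _ _.
by rewrite lee_fin mulr_ge0 // size_biased_ge0.
Qed.

(** The real number x is nu. Below beta_c, either nu <= 1 and tanh beta < 1
    suffices, or exp (2 beta) < (nu + 1) / (nu - 1), which is
    nu tanh beta < 1. *)
Lemma subcritical p (beta : R) : degree_law p -> 0 < beta ->
  (beta%:E < beta_c p)%E ->
  exists x : R, [/\ 0 <= x, th beta * x < 1 &
    forall K, \sum_(0 <= k < K) k%:R * size_biased p k <= x].
Proof.
move=> law b0; have nu0 := nu_ge0 law; have tb0 := th_ge0 (ltW b0).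
have tb1 := th_lt1 beta.
rewrite /beta_c; case: ifPn => [nu1 _|].
  have nufin : nu p \is a fin_num by rewrite ge0_fin_numE // (le_lt_trans nu1) ?ltry.
  exists (fine (nu p)); split; first exact: fine_ge0.
    have : fine (nu p) <= 1 by rewrite -lee_fin fineK.
    by have := fine_ge0 nu0; nra.
  have k0 k : 0 <= k%:R * size_biased p k by rewrite mulr_ge0 // size_biased_ge0.
  by have [] := nneseries_real k0 (esym (fineK nufin)).
rewrite -ltNge => nu1; case: ifPn => [_|nuoo]; first by rewrite lte_fin ltNge ltW.
have nufin : nu p \is a fin_num by rewrite ge0_fin_numE // lt_neqAle nuoo leey.
have x1 : 1 < fine (nu p) by rewrite -lte_fin fineK.
move: (fine (nu p)) (esym (fineK nufin)) x1 => x xE x1.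
rewrite lte_fin /atanh => beta_lt.
exists x; split; first by apply: ltW; apply: lt_trans x1.
  have e_lt : expR (2 * beta) < (x + 1) / (x - 1).
    have -> : (x + 1) / (x - 1) = (1 + 1 / x) / (1 - 1 / x).
      by field; rewrite !subr_eq0 !gt_eqF //; lra.
    have arg0 : 0 < (1 + 1 / x) / (1 - 1 / x).
      have xinv : 1 / x < 1 by rewrite ltr_pdivrMr ?mul1r //; lra.
      have xinv0 : 0 < 1 / x by rewrite divr_gt0 //; lra.
      by rewrite divr_gt0 //; lra.
    rewrite -[X in _ < X](lnK arg0) ltr_expR.
    by move: beta_lt; rewrite ltr_pdivlMr // mulrC.
  have e0 := expR_gt0 (2 * beta).
  move: e_lt; rewrite ltr_pdivlMr; last by lra.
  rewrite thE; move: (expR _) e0 => e e0 ex.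
  have -> : (1 - 2 / (e + 1)) * x = (e - 1) * x / (e + 1).
    by field; rewrite gt_eqF //; lra.
  by rewrite ltr_pdivrMr; lra.
have k0 k : 0 <= k%:R * size_biased p k by rewrite mulr_ge0 // size_biased_ge0.
by have [] := nneseries_real k0 xE.
Qed.

End DegreeLawFacts.
(** * Small fields below the critical temperature *)

Section NeighbourhoodFrequencies.
Variable R : realType.
Implicit Types (q rho : nat -> R).

Lemma nbhd_freq01 N (g : mgraph N) t T : 0 <= (nbhd_freq g t T : R) <= 1.
Proof.
rewrite /nbhd_freq divr_ge0 ?sumr_ge0 //=.
have [N0|N0] := posnP N.
  by rewrite (_ : N%:R = 0) ?invr0 ?mulr0 ?ler01 // N0.
rewrite ler_pdivrMr ?ltr0n // mul1r.
apply: (@le_trans _ _ (\sum_(i < N) 1)).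
  by apply: ler_sum => i _; case: `[< _ >].
by rewrite sumr_const card_ord.
Qed.

(** Local convergence concerns isomorphism classes, while expectations are
    computed over plane trees. The weight w T / P(class of T) shares the frequency
    of a class among its plane trees; for a given vertex i the weights of the
    trees isomorphic to its neighbourhood add up to at most 1, and each of these
    trees bounds the mean of the spin at i. Working with 1 - <s_i> >= 0 allows the
    remaining vertices to be dropped. *)
Lemma site_mean_le_weighted N (g : mgraph N) (i : 'I_N) t (L : seq ptree)
    q rho (beta B : R) :
  0 <= beta -> 0 <= B -> uniq L ->
  (forall k, 0 <= q k) -> (forall k, 0 <= rho k) ->
  (forall T, T \in L -> bp_prob q rho t T \is a fin_num) ->
  \sum_(T <- L) bp_weight q rho t T / fine (bp_prob q rho t T)
      * (`[< rg_iso (nbhd g i t) (tree_graph T) >])%:R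
      * (1 - tree_bound (th B) (th beta) t T)
    <= 1 - site_mean (pair_energy (coupling g beta)) (fun=> B) i.
Proof.
move=> b0 B0 uL q0 rho0 fin.
set y := 1 - _; have y0 : 0 <= y by rewrite subr_ge0 site_mean_le1.
pose iso T := `[< rg_iso (nbhd g i t) (tree_graph T) >].
set w := bp_weight q rho t; have w0 T : 0 <= w T by exact: bp_weight_ge0.
pose S := \sum_(T <- L | iso T) w T.
have S0 : 0 <= S by exact: sumr_ge0.
have S_le T : T \in L -> iso T -> S <= fine (bp_prob q rho t T).
  move=> TL /asboolP isoT; rewrite -lee_fin fineK ?fin //.
  apply: le_trans (bp_prob_ge t T uL q0 rho0); rewrite lee_fin.
  rewrite /S le_eqVlt; apply/orP; left; apply/eqP; apply: eq_bigl => T'.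
  apply/idP/idP => /asboolP H; apply/asboolP.
    by apply: rg_iso_trans isoT; apply: rg_iso_sym H; exists [::]; split.
  by apply: rg_iso_trans isoT _; apply: rg_iso_sym H.
have wS T : T \in L -> iso T -> w T <= S.
  by move=> TL isoT; rewrite /S (big_rem T TL) /= isoT lerDl sumr_ge0.
apply: (@le_trans _ _ (\sum_(T <- L | iso T) w T / S * y)).
  rewrite [X in _ <= X]big_mkcond /= big_seq [X in _ <= X]big_seq.
  apply: ler_sum => T TL; rewrite -/(iso T); case: ifPn => isoT; last by rewrite mulr0 mul0r.
  have [S00|Sn0] := eqVneq S 0.
    have -> : w T = 0 by apply/eqP; rewrite eq_le w0 andbT -S00 wS.
    by rewrite !mul0r.
  have Sgt0 : 0 < S by rewrite lt_neqAle eq_sym Sn0.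
  have pi0 : 0 < fine (bp_prob q rho t T) by exact: lt_le_trans (S_le _ TL isoT).
  rewrite mulr1; apply: (@le_trans _ _ (w T / fine (bp_prob q rho t T) * y)).
    rewrite ler_wpM2l ?divr_ge0 ?(ltW pi0) // lerD2l lerN2.
    by apply: site_mean_le_tree => //; exact/asboolP.
  by rewrite ler_wpM2r // ler_wpM2l // lef_pV2 ?posrE // S_le.
rewrite -!mulr_suml -/S; have [->|Sn0] := eqVneq S 0; first by rewrite !mul0r.
by rewrite divff // mul1r.
Qed.

Lemma magnetization_le_freq N (g : mgraph N) t (L : seq ptree) q rho (beta B : R) :
  (0 < N)%N -> 0 <= beta -> 0 <= B -> uniq L ->
  (forall k, 0 <= q k) -> (forall k, 0 <= rho k) ->
  (forall T, T \in L -> bp_prob q rho t T \is a fin_num) ->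
  magnetization_N g beta B <= 1 -
    \sum_(T <- L) bp_weight q rho t T / fine (bp_prob q rho t T)
      * nbhd_freq g t T * (1 - tree_bound (th B) (th beta) t T).
Proof.
move=> N0 b0 B0 uL q0 rho0 fin; rewrite lerBrDr addrC -lerBrDr.
have NR : 0 < N%:R :> R by rewrite ltr0n.
have -> : 1 - magnetization_N g beta B =
    (\sum_i (1 - site_mean (pair_energy (coupling g beta)) (fun=> B) i)) / N%:R.
  rewrite magnetizationE sumrB sumr_const card_ord mulrBl divff //.
  by rewrite gt_eqF.
rewrite ler_pdivlMr //.
have weighted i := site_mean_le_weighted g i b0 B0 uL q0 rho0 fin.
apply: (le_trans _ (ler_sum _ (fun i _ => weighted i))).
rewrite exchange_big /= mulr_suml le_eqVlt; apply/orP; left; apply/eqP.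
apply: eq_bigr => T _; rewrite -mulr_suml -mulr_sumr /nbhd_freq.
move: (_ / fine _) (1 - _) (\sum_i _) => c z S.
by field; rewrite gt_eqF.
Qed.

(** In the limit the frequency of a class cancels the denominator of the weight,
    leaving the plain weights of the plane trees. *)
Lemma magnetization_le_bp (g : forall N, mgraph N) t (L : seq ptree) q rho
    (beta B e : R) :
  0 <= beta -> 0 <= B -> uniq L ->
  (forall k, 0 <= q k) -> (forall k, 0 <= rho k) ->
  (forall T, T \in L ->
    (fun N => (nbhd_freq (g N) t T)%:E) @ \oo --> bp_prob q rho t T) ->
  0 < e ->
  \forall N \near \oo, magnetization_N (g N) beta B <= 1 + e -
    \sum_(T <- L) bp_weight q rho t T * (1 - tree_bound (th B) (th beta) t T).
Proof.
move=> b0 B0 uL q0 rho0 cvT e0.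
have fin T : T \in L -> bp_prob q rho t T \is a fin_num.
  move=> /cvT cv; rewrite ge0_fin_numE.
    apply: (@le_lt_trans _ _ 1%E); last exact: ltry.
    apply: cvge_to_le cv _; apply: nearW => N.
    by rewrite lee_fin; have /andP[] := nbhd_freq01 (g N) t T.
  by apply: esum_ge0 => T' _; rewrite lee_fin; exact: bp_weight_ge0.
pose u N := \sum_(T <- L) bp_weight q rho t T / fine (bp_prob q rho t T)
      * nbhd_freq (g N) t T * (1 - tree_bound (th B) (th beta) t T).
set l := \sum_(T <- L) _.
have cvu : u @ \oo --> l.
  rewrite /l big_seq (_ : u = fun N => \sum_(T <- L | T \in L)
      bp_weight q rho t T / fine (bp_prob q rho t T)
      * nbhd_freq (g N) t T * (1 - tree_bound (th B) (th beta) t T)); last first.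
    by apply/funext => N; rewrite /u big_seq.
  apply: (cvg_big add_continuous) => T TL; apply: cvgMl.
  have cvf : (fun N => nbhd_freq (g N) t T : R) @ \oo --> fine (bp_prob q rho t T).
    rewrite (_ : (fun _ => _) = fine \o (fun N => (nbhd_freq (g N) t T)%:E)).
      by apply: fine_cvg; rewrite fineK ?fin //; exact: cvT.
    exact/funext.
  have wE : bp_weight q rho t T = bp_weight q rho t T / fine (bp_prob q rho t T)
      * fine (bp_prob q rho t T).
    have [pi0|pin0] := eqVneq (fine (bp_prob q rho t T)) 0; last by rewrite divfK.
    rewrite pi0 mulr0; apply/eqP; rewrite eq_le bp_weight_ge0 // andbT -pi0.
    rewrite -lee_fin fineK ?fin //.
    apply: le_trans (bp_prob_ge t T uL q0 rho0); rewrite lee_fin.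
    rewrite (big_rem T TL) /= asboolT ?lerDl ?sumr_ge0 //; last first.
      by exists id; split=> //; split=> // v; exists v.
    by move=> T' _; exact: bp_weight_ge0.
  by rewrite [X in _ --> X]wE; exact: cvgMr.
near=> N.
have uN : l - e <= u N.
  by near: N; apply: cvgr_ge _ cvu _ _; rewrite gtrBl.
have N0 : (0 < N)%N by near: N; exact: nbhs_infty_gt.
apply: le_trans (magnetization_le_freq (g N) N0 b0 B0 uL q0 rho0 fin) _.
by rewrite -/(u N); lra.
Unshelve. all: by end_near. Qed.

(** The depth m makes the boundary term r ^ m small, then the field h makes the
    field term small, and finally K makes the lost mass small. *)
Lemma subcritical_magnetization (p : nat -> R) (beta eta : R) :
  degree_law p -> 0 < beta -> (beta%:E < beta_c p)%E -> 0 < eta ->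
  exists2 h : R, 0 < h & exists t, exists2 L : seq ptree, all (depth_le t) L &
    forall g : (forall N, mgraph N),
      (forall T, T \in L -> (fun N => (nbhd_freq (g N) t T)%:E) @ \oo -->
         bp_prob p (size_biased p) t T) ->
      \forall N \near \oo, magnetization_N (g N) beta h <= eta.
Proof.
move=> law b0 bc eta0.
have [x [x0 rx1 xE]] := subcritical law b0 bc.
have [plaw pfull] := degree_law_mass law.
have [rlaw rfull] := size_biased_mass law.
have [p0 _] := plaw; have [rho0 _] := rlaw.
have m0 := mean_degree_gt0 law; set D := mean_degree p in m0.
have tb0 := th_ge0 (ltW b0); set theta := th beta in tb0 rx1.
set r := theta * x in rx1; have r0 : 0 <= r by exact: mulr_ge0.
have tD0 : 0 <= theta * D by rewrite mulr_ge0 // ltW.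
have [m Hm] : exists m, theta * D * r ^+ m <= eta / 4.
  have cv : (fun n => theta * D * r ^+ n) @ \oo --> theta * D * 0.
    by apply: cvgMr; apply: cvg_expr; rewrite ger0_norm.
  rewrite mulr0 in cv.
  have [n _ Hn] := cvgr_le _ cv _ (divr_gt0 eta0 (ltr0n _ 4)).
  by exists n; apply: Hn => /=.
pose C := 1 + theta * D / (1 - r).
have C0 : 0 < C by rewrite ltr_wpDr // divr_ge0 // subr_ge0 ltW.
pose h := eta / 8 / C.
have h0 : 0 < h by rewrite !divr_gt0.
exists h => //; exists m.+1.
have [K HK] := bp_mass_near1 m plaw pfull rlaw rfull (divr_gt0 eta0 (ltr0n _ 4)).
exists (bounded_trees K m.+1); first by apply/allP => T; exact: bounded_trees_depth.
move=> g cvT.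
have := magnetization_le_bp (ltW b0) (ltW h0) (bounded_trees_uniq K m.+1) p0 rho0
  cvT (divr_gt0 eta0 (ltr0n _ 4)).
apply: filterS => N /le_trans; apply.
have a0 := th_ge0 (ltW h0); have a2 := th_le2 (ltW h0).
have bound := bp_tree_bound m plaw rlaw a0 tb0 (mean_degree_bound law K).
have inner := gw_tree_bound K m rlaw a0 tb0 x0 rx1 xE.
rewrite -/r in inner.
have total : \sum_(T <- bounded_trees K m.+1)
    bp_weight p (size_biased p) m.+1 T * tree_bound (th h) theta m.+1 T <= eta / 2.
  apply: le_trans bound _; rewrite -/D.
  apply: le_trans (lerD (lexx _) (ler_wpM2l tD0 inner)) _.
  have -> : th h + theta * D * (th h / (1 - r) + r ^+ m) =
      th h * C + theta * D * r ^+ m.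
    by rewrite /C; ring.
  have : th h * C <= eta / 4.
    apply: le_trans (ler_wpM2r (ltW C0) a2) _.
    by rewrite /h le_eqVlt; apply/orP; left; apply/eqP; field; rewrite gt_eqF.
  by move: Hm; lra.
under [X in _ - X]eq_bigr do rewrite mulrBr mulr1.
rewrite sumrB -/theta.
by move: HK total; lra.
Qed.

End NeighbourhoodFrequencies.

(** * Almost sure concentration *)

Section Concentration.
Context {R : realType} {d : measure_display} {Omega : measurableType d}.
Variables (P : probability Omega R) (G : forall N : nat, Omega -> mgraph N).

Lemma ae_in_seq (I : eqType) (L : seq I) (Q : I -> Omega -> Prop) :
  (forall i, i \in L -> {ae P, forall w, Q i w}) ->
  {ae P, forall w, forall i, i \in L -> Q i w}.
Proof.
elim: L => [|i L IH] H; first exact: nearW.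
have Hi := H i (mem_head _ _).
have HL : {ae P, forall w, forall i, i \in L -> Q i w}.
  by apply: IH => j jL; apply: H; rewrite inE jL orbT.
by apply: filterS2 Hi HL => w Qi QL j; rewrite inE => /predU1P[->|/QL].
Qed.

Lemma magnetization_sides (p : nat -> R) (beta B eta : R) :
  degree_law p -> locally_tree_like P G p -> U_qu p beta B -> 0 < eta ->
  {ae P, forall w, exists2 t : R, 0 < t &
    \forall N \near \oo,
      magnetization_N (G N w) beta (B + t) <= magnetization_N (G N w) beta B + eta /\
      magnetization_N (G N w) beta B - eta <= magnetization_N (G N w) beta (B - t)}.
Proof.
move=> law tree [[b0 Bn0]|[b0 bc ->]] eta0.
  have [t t0 H] := magnetization_right_left b0 Bn0 eta0.
  by apply: nearW => w; exists t => //; apply: nearW => N.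
have [t t0 [l [L Ldepth H]]] := subcritical_magnetization law b0 bc eta0.
have := ae_in_seq (fun T TL => tree l T (allP Ldepth T TL)).
apply: filterS => w cvT; exists t => //.
have := H (fun N => G N w) cvT; apply: filterS => N Mt.
by rewrite sub0r magnetizationN magnetization0 !add0r lerN2.
Qed.

Lemma exponential_concentration (p : nat -> R) (beta B M eps : R) :
  degree_law p -> locally_tree_like P G p -> U_qu p beta B ->
  is_magnetization P G beta B M -> 0 < eps ->
  {ae P, forall w, exists2 L : R, 0 < L &
    \forall N \near \oo,
      ising_prob (G N w) beta B
        (fun s => eps <= `|total_spin s / N%:R - M|) <= expR (- (N%:R * L))}.
Proof.
move=> law tree U Mlim eps0.
have eps4 : 0 < eps / 4 by rewrite divr_gt0.
have sides := magnetization_sides law tree U eps4.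
apply: filterS2 Mlim sides => w cvM [t t0 near_sides].
have L0 : 0 < t * eps / 4 by rewrite divr_gt0 // mulr_gt0.
exists (t * eps / 4) => //.
near=> N.
have [up down] : magnetization_N (G N w) beta (B + t) <= magnetization_N (G N w) beta B + eps / 4 /\
      magnetization_N (G N w) beta B - eps / 4 <= magnetization_N (G N w) beta (B - t).
  by near: N.
have Mup : magnetization_N (G N w) beta B <= M + eps / 4.
  by near: N; apply: cvgr_le _ cvM _ _; rewrite ltrDl.
have Mdown : M - eps / 4 <= magnetization_N (G N w) beta B.
  by near: N; apply: cvgr_ge _ cvM _ _; rewrite gtrBl.
apply: ising_tail => //; [exact: ltW| |lra|lra].
rewrite -ler_pdivrMr // mul1r; near: N.
exists (Num.truncn (t * eps / 4)^-1).+1 => //= N HN.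
by apply: le_trans (ltW (truncnS_gt _)) _; rewrite ler_nat.
Unshelve. all: by end_near. Qed.

End Concentration.

Theorem theorem1p2 (R : realType) (d : measure_display)
    (Omega : measurableType d) (P : probability Omega R)
    (G : forall N : nat, Omega -> mgraph N) (p : nat -> R)
    (G_random : random_graphs G)
    (p_law : degree_law p)
    (G_tree : locally_tree_like P G p)
    (G_sparse : uniformly_sparse P G)
    (p_sfm : strongly_finite_mean p)
    (beta B : R) (betaB_U : U_qu p beta B)
    (M : R) (M_lim : is_magnetization P G beta B M) :
  {ae P, forall w, forall eps : R, 0 < eps ->
    exists2 L : R, 0 < L &
      \forall N \near \oo,
        ising_prob (G N w) beta B
          (fun s => eps <= `|total_spin s / N%:R - M|) <= expR (- (N%:R * L))}.
Proof.
have : {ae P, forall w, forall n : nat, exists2 L : R, 0 < L &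
    \forall N \near \oo,
      ising_prob (G N w) beta B
        (fun s => n.+1%:R^-1 <= `|total_spin s / N%:R - M|) <= expR (- (N%:R * L))}.
  apply/ae_foralln => n.
  by apply: exponential_concentration p_law G_tree betaB_U M_lim _; rewrite invr_gt0.
apply: filterS => w H eps eps0.
pose n := Num.truncn eps^-1.
have n_eps : n.+1%:R^-1 <= eps.
  rewrite -[X in _ <= X]invrK lef_pV2 ?posrE ?invr_gt0 //.
  exact/ltW/truncnS_gt.
have [L L0 HL] := H n; exists L => //.
apply: filterS HL => N; apply: le_trans.
rewrite /ising_prob big_mkcond [X in _ <= X]big_mkcond; apply: ler_sum => s _.
have ising0 : 0 <= ising (G N w) beta B s.
  rewrite /ising boltzmannE partition_functionE divr_ge0 ?expR_ge0 //.
  exact/ltW/gibbs_sum_gt0.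
case: ifPn => far; last by case: ifP.
by rewrite (le_trans n_eps far).
Qed.
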